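(* Let $X: M\to\mathbb{R}^{m+n}$ be an oriented $n$-dimensional self-shrinker, i.e. an immersed submanifold satisfying $H=-\frac{1}{2}X^N$, and let $\rho:=e^{-|X|^2/4}$. Then its Gauss map $\gamma:M\to\mathbf{G}_{n,m}$ is a $\rho$-weighted harmonic map.
   Context: $M$ carries the metric $g$ induced by the immersion $X$. $(\cdot)^N$ denotes orthogonal projection onto the normal bundle; $X$ also denotes the position vector. With $\overline\nabla$ the Levi-Civita connection of $\mathbb{R}^{m+n}$, the second fundamental form is $B_{VW}=(\overline\nabla_V W)^N$, and the mean curvature vector $H$ is the trace of $B$ with respect to $g$ (no factor $1/n$). $\mathbf{G}_{n,m}$ is the Grassmannian of oriented $n$-dimensional linear subspaces of $\mathbb{R}^{m+n}$, with its canonical Riemannian metric (that induced by the Plücker embedding $P\mapsto e_1\wedge\cdots\wedge e_n$, where $e_1,\dots,e_n$ is an oriented orthonormal basis of $P$). The Gauss map $\gamma$ sends $p\in M$ to the oriented subspace obtained by parallel translating $T_pM$ to the origin. Weighted harmonic maps: let $f:(M,g)\to(N,h)$ be a smooth map between Riemannian manifolds and $w$ a smooth positive function on $M$. The $w$-weighted tension field is $\tau_w(f)=w^{-1}\sum_i\big(\nabla_{e_i}(w\,df)\big)(e_i)$, where $\{e_i\}$ is a local orthonormal frame on $M$ and $\nabla$ is the natural connection on $T^*M\otimes f^{-1}TN$. The map $f$ is called $w$-weighted harmonic if $\tau_w(f)=0$ (equivalently, $f$ is a critical point, under compactly supported variations, of the weighted energy $\frac12\int_\Omega\sum_i\langle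 f_*e_i,f_*e_i\rangle\, w$ for relatively compact domains $\Omega\subset M$). *)

(* Defs.v *)
From HB Require Import structures.
From mathcomp Require Import all_boot all_order all_algebra.
From mathcomp Require Import all_classical all_reals all_analysis.

Set Implicit Arguments.
Unset Strict Implicit.
Unset Printing Implicit Defensive.

Import Order.TTheory GRing.Theory Num.Theory.
Import numFieldNormedType.Exports.

Local Open Scope classical_set_scope.
Local Open Scope ring_scope.

(* The topology of 'rV[R]_n is the usual one, but its library norm is the sup
   norm; the Euclidean inner product is dot. *)
Definition dot (R : realType) (n : nat) (u v : 'rV[R]_n) : R :=
  \sum_(i < n) u ord0 i * v ord0 i.

Definition partial (R : realType) (n : nat) (V : normedModType R) (i : 'I_n)
    (f : 'rV[R]_n -> V) (x : 'rV[R]_n) : V :=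
  'D_(delta_mx ord0 i : 'rV[R]_n) f x.

(* Class C^k at all points of U, which is open in all the uses below. *)
Fixpoint classC (R : realType) (n l k : nat) (U : set 'rV[R]_n)
    (f : 'rV[R]_n -> 'rV[R]_l) {struct k} : Prop :=
  if k is k'.+1 then
    (forall x, U x -> differentiable f x) /\
    (forall i : 'I_n, classC k' U (partial i f))
  else forall x, U x -> {for x, continuous f}.

Definition smooth (R : realType) (n l : nat) (U : set 'rV[R]_n)
    (f : 'rV[R]_n -> 'rV[R]_l) : Prop :=
  forall k, classC k U f.

(* coord is relevant only on dom, and param, the inverse of coord, only on
   coord @` dom. *)
Record chart (R : realType) (n : nat) (M : Type) := Chart {
  dom : set M;
  coord : M -> 'rV[R]_n;
  param : 'rV[R]_n -> M }.

Definition transition_dom (R : realType) (n : nat) (M : Type)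
    (c d : chart R n M) : set 'rV[R]_n :=
  coord c @` (dom c `&` dom d).

Definition transition (R : realType) (n : nat) (M : Type)
    (c d : chart R n M) : 'rV[R]_n -> 'rV[R]_n :=
  coord d \o param c.

(* An orientation is given by an atlas A all of whose charts are positive. *)
Record oriented_manifold (R : realType) (n : nat) (M : topologicalType)
    (A : set (chart R n M)) : Prop := OrientedManifold {
  om_hausdorff : hausdorff_space M;
  om_second_countable : @second_countable M;
  om_cover : forall p, exists2 c, A c & dom c p;
  om_dom_open : forall c, A c -> open (dom c);
  om_image_open : forall c, A c -> open (coord c @` dom c);
  om_coord_cont : forall c, A c -> {within dom c, continuous (coord c)};
  om_param_cont :
    forall c, A c -> {within coord c @` dom c, continuous (param c)};
  om_coordK : forall c, A c -> forall p, dom c p -> param c (coord c p) = p;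
  om_smooth :
    forall c d, A c -> A d -> smooth (transition_dom c d) (transition c d);
  om_positive :
    forall c d, A c -> A d -> forall x, transition_dom c d x ->
      0 < \det ('J (transition c d) x) }.

(* The openness clause says that f is continuous for the topologies defined by
   the atlases. *)
Definition smooth_map (R : realType) (n l : nat) (M N : Type)
    (A : set (chart R n M)) (B : set (chart R l N)) (f : M -> N) : Prop :=
  forall c d, A c -> B d ->
    open (coord c @` (dom c `&` f @^-1` dom d)) /\
    smooth (coord c @` (dom c `&` f @^-1` dom d)) (coord d \o f \o param c).

(* g c x is the matrix of the metric in the coordinates of the chart c, at the
   point of coordinates x. *)
Definition metric (R : realType) (n : nat) (M : Type) :=
  chart R n M -> 'rV[R]_n -> 'M[R]_n.

(* Row i of the Jacobian matrix 'J F is the partial derivative of F along the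
   i-th coordinate. *)
Definition induced_metric (R : realType) (n k : nat) (M : Type)
    (F : M -> 'rV[R]_k) : metric R n M :=
  fun c x => \matrix_(i, j) dot (row i ('J (F \o param c) x))
                                (row j ('J (F \o param c) x)).

(* The Christoffel symbol Gamma^k_ij of the Levi-Civita connection of g. *)
Definition christoffel (R : realType) (n : nat) (g : 'rV[R]_n -> 'M[R]_n)
    (x : 'rV[R]_n) (k i j : 'I_n) : R :=
  2^-1 * \sum_(l < n) invmx (g x) k l *
    (partial i (fun y => g y j l : R^o) x
     + partial j (fun y => g y i l : R^o) x
     - partial l (fun y => g y i j : R^o) x).

(* Coordinates of (nabla_{d_i} eta)(d_j), for a section eta of
   T^*M (x) f^{-1}TN; eta y j a is the component along d_a of eta(d_j) at y. *)
Definition cov_deriv (R : realType) (n l : nat)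
    (g : 'rV[R]_n -> 'M[R]_n) (h : 'rV[R]_l -> 'M[R]_l)
    (f : 'rV[R]_n -> 'rV[R]_l) (eta : 'rV[R]_n -> 'M[R]_(n, l))
    (x : 'rV[R]_n) (i j : 'I_n) : 'rV[R]_l :=
  \row_a (partial i (fun y => eta y j a : R^o) x
          - \sum_(k < n) christoffel g x k i j * eta x k a
          + \sum_(b < l) \sum_(c < l)
              christoffel h (f x) a b c * 'J f x i b * eta x j c).

(* The sum over an orthonormal frame is the trace with respect to g, whose
   coordinate expression uses the inverse matrix of g. *)
Definition weighted_tension (R : realType) (n l : nat)
    (g : 'rV[R]_n -> 'M[R]_n) (h : 'rV[R]_l -> 'M[R]_l)
    (w : 'rV[R]_n -> R) (f : 'rV[R]_n -> 'rV[R]_l)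
    (x : 'rV[R]_n) : 'rV[R]_l :=
  (w x)^-1 *: \sum_(i < n) \sum_(j < n)
    invmx (g x) i j *: cov_deriv g h f (fun y => w y *: 'J f y) x i j.

Definition weighted_harmonic (R : realType) (n l : nat) (M N : Type)
    (A : set (chart R n M)) (g : metric R n M)
    (B : set (chart R l N)) (h : metric R l N)
    (w : M -> R) (f : M -> N) : Prop :=
  smooth_map A B f /\
  forall c d p, A c -> B d -> dom c p -> dom d (f p) ->
    weighted_tension (g c) (h d) (w \o param c)
      (coord d \o f \o param c) (coord c p) = 0.

(* An oriented subspace is represented by the set of its positively oriented
   bases, a basis being the list of the rows of an n x k matrix. *)
Definition oriented_bases (R : realType) (n k : nat)
    (S : set 'M[R]_(n, k)) : Prop :=
  exists2 B, row_free B & S = [set Q *m B | Q in [set Q | 0 < \det Q]].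

Definition oriented_grassmannian (R : realType) (n k : nat) : Type :=
  {S : set 'M[R]_(n, k) | oriented_bases S}.

HB.instance Definition _ (R : realType) (n k : nat) :=
  gen_eqMixin (oriented_grassmannian R n k).
HB.instance Definition _ (R : realType) (n k : nat) :=
  gen_choiceMixin (oriented_grassmannian R n k).

Notation "''G[' R ]_ ( n , m )" := (oriented_grassmannian R n (m + n))
  (at level 8, n at level 2, m at level 2, format "''G[' R ]_ ( n ,  m )").

Definition positive_basis (R : realType) (n k : nat)
    (P : oriented_grassmannian R n k) (B : 'M[R]_(n, k)) : Prop :=
  proj1_sig P B.

Lemma standard_oriented_bases (R : realType) (n m : nat) :
  @oriented_bases R n (m + n)
    [set Q *m row_mx 0 1%:M | Q in [set Q | 0 < \det Q]].
Proof.
exists (row_mx 0 1%:M) => //; apply/row_freeP.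
by exists (col_mx 0 1%:M); rewrite mul_row_col mul0mx mul1mx add0r.
Qed.

(* Default value for the choices below. *)
Definition standard_plane (R : realType) (n m : nat) : 'G[R]_(n, m) :=
  exist _ _ (@standard_oriented_bases R n m).

(* The oriented span of the rows of B, meaningful if they are independent. *)
Definition oriented_span (R : realType) (n m : nat)
    (B : 'M[R]_(n, m + n)) : 'G[R]_(n, m) :=
  xget (standard_plane R n m) [set P | positive_basis P B].

Lemma positive_basis_span (R : realType) (n m : nat) (B : 'M[R]_(n, m + n)) :
  row_free B -> positive_basis (oriented_span B) B.
Proof.
move=> Bfree.
have SB : oriented_bases [set Q *m B | Q in [set Q | 0 < \det Q]] by exists B.
apply: (@xgetPex _ _ [set P : 'G[R]_(n, m) | positive_basis P B]).
exists (exist _ _ SB); exists 1%:M; last by rewrite mul1mx.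
by rewrite /= det1.
Qed.

(* The chart around the oriented span of E formed by the graphs of the linear
   maps from this span to its orthogonal complement: when E and F are
   orthonormal bases of the two subspaces, the coordinates of the subspace with
   positive basis E + Z *m F are the entries of Z. *)
Definition graph_chart (R : realType) (n m : nat)
    (E : 'M[R]_(n, m + n)) (F : 'M[R]_(m, m + n)) :
    chart R (n * m) 'G[R]_(n, m) :=
  let basis z := E + vec_mx z *m F in
  {| dom := [set P | exists z, positive_basis P (basis z)];
     coord := fun P => xget 0 [set z | positive_basis P (basis z)];
     param := fun z => oriented_span (basis z) |}.

Definition grassmannian_atlas (R : realType) (n m : nat) :
    set (chart R (n * m) 'G[R]_(n, m)) :=
  [set c | exists E F, [/\ E *m E^T = 1%:M, E *m F^T = 0, F *m F^T = 1%:M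
                         & c = graph_chart E F]].

(* Strictly increasing multi-indices i_1 < ... < i_n; they index the canonical
   orthonormal basis of the n-th exterior power of R^k. *)
Definition increasing (n k : nat) : pred {ffun 'I_n -> 'I_k} :=
  fun s => [forall i : 'I_n, forall j : 'I_n, (i < j)%N ==> (s i < s j)%N].

Notation multi_index n k := {s : {ffun 'I_n -> 'I_k} | increasing s}.

(* Components of the exterior product of the rows of B. *)
Definition wedge (R : realType) (n k : nat) (B : 'M[R]_(n, k)) :
    'rV[R]_#|{: multi_index n k}| :=
  \row_(s < #|{: multi_index n k}|) \det (colsub (val (enum_val s)) B).

Definition plucker (R : realType) (n k : nat)
    (P : oriented_grassmannian R n k) : 'rV[R]_#|{: multi_index n k}| :=
  wedge (xget 0 [set B | positive_basis P B /\ B *m B^T = 1%:M]).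

Definition grassmannian_metric (R : realType) (n m : nat) :
    metric R (n * m) 'G[R]_(n, m) :=
  induced_metric (@plucker R n (m + n)).

(* The rows are the coordinate tangent vectors at p. *)
Definition tangent_basis (R : realType) (n k : nat) (M : Type)
    (X : M -> 'rV[R]_k) (c : chart R n M) (p : M) : 'M[R]_(n, k) :=
  'J (X \o param c) (coord c p).

Definition immersion (R : realType) (n k : nat) (M : Type)
    (A : set (chart R n M)) (X : M -> 'rV[R]_k) : Prop :=
  forall c, A c ->
    smooth (coord c @` dom c) (X \o param c) /\
    forall p, dom c p -> row_free (tangent_basis X c p).

(* Orthogonal projection of v on the orthogonal complement of the row space
   of J, for J with independent rows. *)
Definition normal_part (R : realType) (n k : nat) (J : 'M[R]_(n, k))
    (v : 'rV[R]_k) : 'rV[R]_k :=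
  v - v *m J^T *m invmx (J *m J^T) *m J.

(* B_{VW} for V and W the i-th and j-th coordinate vector fields of c. *)
Definition second_fundamental_form (R : realType) (n k : nat) (M : Type)
    (X : M -> 'rV[R]_k) (c : chart R n M) (p : M) (i j : 'I_n) : 'rV[R]_k :=
  normal_part (tangent_basis X c p)
    (partial i (partial j (X \o param c)) (coord c p)).

Definition mean_curvature (R : realType) (n k : nat) (M : Type)
    (X : M -> 'rV[R]_k) (c : chart R n M) (p : M) : 'rV[R]_k :=
  \sum_(i < n) \sum_(j < n)
    invmx (induced_metric X c (coord c p)) i j
      *: second_fundamental_form X c p i j.

Definition self_shrinker (R : realType) (n k : nat) (M : Type)
    (A : set (chart R n M)) (X : M -> 'rV[R]_k) : Prop :=
  immersion A X /\
  forall c p, A c -> dom c p ->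
    mean_curvature X c p = - 2^-1 *: normal_part (tangent_basis X c p) (X p).

Definition gauss_map (R : realType) (n m : nat) (M : Type)
    (A : set (chart R n M)) (X : M -> 'rV[R]_(m + n)) (p : M) : 'G[R]_(n, m) :=
  xget (standard_plane R n m)
    [set P | forall c, A c -> dom c p -> positive_basis P (tangent_basis X c p)].

Definition gaussian_weight (R : realType) (k : nat) (M : Type)
    (X : M -> 'rV[R]_k) (p : M) : R :=
  expR (- (dot (X p) (X p) / 4)).

(* Main.v *)
(* The tangent space at x has positive basis J = 'J X; in the chart of the
   Grassmannian given by orthonormal E, F the Gauss map reads
   Z = (J E^T)^-1 (J F^T).  There the metric is
   h_Z(V, W) = tr (S^-1 V T^-1 W^T), S = 1 + Z Z^T, T = 1 + Z^T Z (Cauchy-Binet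
   and rank-two updates of det S), so that its Christoffel symbols give
   Gamma_Z(V, W) = - (V Z^T S^-1 W + W Z^T S^-1 V).
   The columns of P = F^T - E^T Z are normal vectors, and (J E^T) d_j Z = d_j J P
   is the second fundamental form paired with P.  Differentiating once more, the
   weighted tension of Z multiplied by J E^T is the derivative of
   (H + X^N / 2) P = 0, the mixed terms cancelling by the symmetry of the second
   and third derivatives of X (Codazzi). *)
From mathcomp Require Import all_boot all_order all_algebra fingroup perm.
From mathcomp Require Import all_classical all_reals all_analysis.
From mathcomp Require Import ring lra.
Require Import Defs.

Set Implicit Arguments.
Unset Strict Implicit.
Unset Printing Implicit Defensive.

Import Order.TTheory GRing.Theory Num.Theory.
Import numFieldNormedType.Exports.

Local Open Scope ring_scope.

(** * Linear algebra *)

(** The tension is computed at an arbitrary point of an arbitrary graph chart, where [Z] need not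
    vanish, so neither connection can be normalised away. What organises the cancellation is the
    splitting of [E^T] into a tangential and a normal part inside every product [dJ E^T dZ]. The
    tangential part yields the Christoffel symbols of the induced metric; the normal part is exactly
    the quadratic term of the connection of the Grassmannian. In the differentiated shrinker
    equation the same normal part appears as a right multiple of the undifferentiated equation,
    hence vanishes. The weight enters because [dX P = 0]: the derivative of [X P / 2] comes only
    from [dP = - E^T dZ], and its tangential part pairs the gradient of [log rho] with the second
    fundamental form. On the side of the Grassmannian, the exterior product of the rows of [E + Z F]
    is affine in each single entry of [Z]. Its first derivatives are therefore finite differences,
    and the Plucker metric at any [Z] becomes an identity between determinants. *)

Lemma leq_increasing_ord (n : nat) (g : 'I_n -> 'I_n) :
  (forall i j : 'I_n, (i < j)%N -> (g i < g j)%N) -> forall i : 'I_n, (i <= g i)%N.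
Proof.
move=> gi [i]; elim: i => [//|i IHi] lti /=.
have := gi (Ordinal (ltnW lti)) (Ordinal lti) (ltnSn i).
exact: leq_ltn_trans (IHi _).
Qed.

Lemma increasingP (n k : nat) (s : {ffun 'I_n -> 'I_k}) :
  reflect (forall i j : 'I_n, (i < j)%N -> (s i < s j)%N) (increasing s).
Proof.
apply: (iffP forallP) => [H i j ij|H i]; first by move: (H i) => /forallP/(_ j)/implyP; apply.
by apply/forallP => j; apply/implyP => /H.
Qed.

Lemma increasing_ltn (n k : nat) (s : {ffun 'I_n -> 'I_k}) (i j : 'I_n) :
  increasing s -> (s i < s j)%N -> (i < j)%N.
Proof.
move=> /increasingP si sij; case: (ltngtP i j) sij => // [/si ji|/val_inj ->].
  by rewrite ltnNge (ltnW ji).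
by rewrite ltnn.
Qed.

(** An injection of ['I_n] into ['I_k] is uniquely a permutation followed by an increasing map; the
    next two lemmas establish this bijection, which reindexes the Cauchy-Binet sum. *)
Definition permuted_index (n k : nat) (x : multi_index n k * 'S_n) :
  {ffun 'I_n -> 'I_k} := [ffun i => val x.1 (x.2 i)].

Lemma permuted_index_inj (n k : nat) : injective (@permuted_index n k).
Proof.
move=> [s u] [t v] e.
have e' i : val s (u i) = val t (v i) by have /ffunP/(_ i) := e; rewrite !ffunE.
(* Increasing maps reflect the order, so the common values determine the order of the [u i] as well
   as that of the [v i]. *)
have uv i j : (u i < u j)%N = (v i < v j)%N.
  apply/idP/idP => h.
    apply: (increasing_ltn (valP t)); rewrite -!e'.
    exact: (increasingP _ (valP s)).
  apply: (increasing_ltn (valP s)); rewrite !e'.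
  exact: (increasingP _ (valP t)).
have uvE : u = v.
  (* [v \o u^-1] and its inverse are increasing self-maps of ['I_n], so each lies above the
     identity. *)
  apply/permP => i; apply/val_inj/anti_leq/andP; split.
    rewrite -[in leqRHS](permK u i).
    apply: (@leq_increasing_ord n (fun j => v (u^-1%g j))) => a b ab.
    by rewrite -uv !permKV.
  rewrite -[in leqRHS](permK v i).
  apply: (@leq_increasing_ord n (fun j => u (v^-1%g j))) => a b ab.
  by rewrite uv !permKV.
rewrite -uvE in e' *; congr (_, _); apply/val_inj/ffunP => i.
by rewrite -(permKV u i) e'.
Qed.

(** Sorting the image of [f] gives the increasing index; the permutation records the rank of each
    value of [f]. *)
Lemma permuted_index_codom (n k : nat) (f : {ffun 'I_n -> 'I_k}) :
  injective f -> exists x, f = permuted_index x.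
Proof.
move=> fi; pose A := f @: predT.
have cA : n = #|A| by rewrite card_imset // card_ord.
pose s : {ffun 'I_n -> 'I_k} := [ffun i => enum_val (cast_ord cA i)].
have s_incr : increasing s.
  apply/increasingP => i j ij; rewrite !ffunE.
  have x0 := s i.
  rewrite !(enum_val_nth x0) /=.
  have srt : sorted (relpre val ltn) (enum A).
    rewrite -/(sorted _ _) {1}/enum_mem.
    apply: sorted_filter; first by move=> a b c /=; apply: ltn_trans.
    by rewrite -enumT -sorted_map val_enum_ord iota_ltn_sorted.
  by apply: (sorted_ltn_nth _ _ srt) => //;
    rewrite ?inE -?cardE -?cA // => a b c /=; apply: ltn_trans.
have fA (i : 'I_n) : f i \in A by apply: imset_f.
pose u i : 'I_n := cast_ord (esym cA) (enum_rank_in (fA i) (f i)).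
have su i : s (u i) = f i.
  by rewrite ffunE cast_ordKV enum_rankK_in.
have ui : injective u by move=> i j e; apply: fi; rewrite -!su e.
exists (exist _ s s_incr, perm ui); apply/ffunP => i.
by rewrite ffunE permE /= su.
Qed.

(** Multilinearity expands the determinant over all maps [f] from rows to columns; grouping the
    injective ones by their image rebuilds a minor of [B] next to each minor of [C]. *)
Theorem cauchy_binet (R : comNzRingType) (n k : nat) (B C : 'M[R]_(n, k)) :
  \det (B *m C^T) = \sum_(s : multi_index n k)
    \det (colsub (val s) B) * \det (colsub (val s) C).
Proof.
have detE (f : {ffun 'I_n -> 'I_k}) : \det (colsub f C) =
    \sum_(u : 'S_n) (-1) ^+ u * \prod_i C (u i) (f i).
  rewrite -det_tr; apply: eq_bigr => u _; congr (_ * _).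
  by apply: eq_bigr => i _; rewrite !mxE.
have -> : \det (B *m C^T) = \sum_(f : {ffun 'I_n -> 'I_k})
    (\prod_i B i (f i)) * \det (colsub f C).
  under [RHS]eq_bigr => f _ do rewrite detE big_distrr /=.
  rewrite exchange_big /=; apply: eq_bigr => u _.
  under [RHS]eq_bigr => f _ do rewrite mulrCA -big_split /=.
  rewrite -big_distrr /=; congr (_ * _).
  rewrite -(bigA_distr_bigA (fun i j => B i j * C (u i) j)) /=.
  by apply: eq_bigr => i _; rewrite mxE; apply: eq_bigr => j _; rewrite mxE.
(* A non-injective [f] repeats a column of [C], so its determinant is zero. *)
rewrite (bigID (fun f : {ffun 'I_n -> 'I_k} => injectiveb f)) /=.
rewrite [X in _ + X]big1 ?addr0 => [|f /injectivePn[i [j ij fij]]]; last first.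
  rewrite -det_tr (determinant_alternate ij) ?mulr0 // => l.
  by rewrite !mxE fij.
rewrite (eq_bigl (fun f => f \in imset (@permuted_index n k) (mem predT))); last first.
  move=> f; apply/injectiveP/imsetP => [/permuted_index_codom[x ->]|[[s u] _ ->]].
    by exists x.
  move=> i j; rewrite !ffunE /= => e; apply: (@perm_inj _ u).
  by case: (ltngtP (u i) (u j)) => [||/val_inj //];
    move=> /(increasingP _ (valP s)); rewrite e ltnn.
rewrite big_imset /=; last by move=> x y _ _; apply: permuted_index_inj.
pose F (s : multi_index n k) (u : 'S_n) :=
  (\prod_i B i (val s (u i))) * ((-1) ^+ u * \det (colsub (val s) C)).
transitivity (\sum_x F x.1 x.2).
  apply: eq_big => [x|[s u] _ /=]; first by rewrite !inE.
  congr (_ * _); first by apply: eq_bigr => i _; rewrite ffunE.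
  (* Sorting the columns of [C] releases the sign of [u], which is the sign that the product of
     entries of [B] needs to form a determinant. *)
  have -> : colsub (permuted_index (s, u)) C = col_perm u (colsub (val s) C).
    by apply/matrixP => i j; rewrite !mxE ffunE.
  by rewrite col_permE det_mulmx det_perm mulrC odd_permV.
rewrite -(pair_bigA _ F) /=; apply: eq_bigr => s _.
rewrite /F; under eq_bigr do rewrite mulrA.
rewrite -big_distrl /=; congr (_ * _).
apply: eq_bigr => u _; rewrite mulrC; congr (_ * _).
by apply: eq_bigr => i _; rewrite mxE.
Qed.

(** Sylvester's identity: the block matrix with rows [1, -A] and [B, 1] is factored into triangular
    blocks in two ways. *)
Lemma det_addM (R : comNzRingType) (n p : nat) (A : 'M[R]_(n, p)) (B : 'M[R]_(p, n)) :
  \det (1%:M + A *m B) = \det (1%:M + B *m A).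
Proof.
pose L := block_mx 1%:M 0 B 1%:M : 'M[R]_(n + p).
have e1 : block_mx 1%:M (- A) B 1%:M = L *m block_mx 1%:M (- A) 0 (1%:M + B *m A).
  rewrite mulmx_block !mul1mx !mulmx1 ?mul0mx ?mulmx0 !addr0 mulmxN.
  by rewrite [- _ + _]addrC addrK.
have e2 : block_mx 1%:M (- A) B 1%:M = block_mx (1%:M + A *m B) (- A) 0 1%:M *m L.
  by rewrite mulmx_block !mul1mx !mulmx1 ?mul0mx ?mulmx0 !add0r mulNmx addrK.
have := congr1 (@determinant _ _) e1; rewrite e2 !det_mulmx !det_ublock !det_lblock.
by rewrite !det1 !mulr1 !mul1r.
Qed.

Lemma det_addmx (R : comUnitRingType) (n p : nat) (S : 'M[R]_n) (U : 'M[R]_(n, p))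
    (K : 'M[R]_(p, n)) : S \in unitmx ->
  \det (S + U *m K) = \det S * \det (1%:M + K *m invmx S *m U).
Proof.
move=> uS; rewrite -mulmxA -det_addM -det_mulmx; congr (\det _).
by rewrite mulmxDr mulmx1 -mulmxA mulKVmx.
Qed.

Lemma det_mx22 (R : comNzRingType) (M : 'M[R]_(1 + 1)) :
  \det M = M (lshift 1 0) (lshift 1 0) * M (rshift 1 0) (rshift 1 0)
         - M (lshift 1 0) (rshift 1 0) * M (rshift 1 0) (lshift 1 0).
Proof.
rewrite (expand_det_row _ (lshift 1 0)) big_split_ord !big_ord1 /=.
rewrite /cofactor !det_mx11 !mxE.
have -> : lift (lshift 1 0 : 'I_(1 + 1)) (0 : 'I_1) = rshift 1 0 by apply/val_inj.
have -> : lift (rshift 1 0 : 'I_(1 + 1)) (0 : 'I_1) = lshift 1 0 by apply/val_inj.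
by rewrite expr0 mul1r expr1 mulN1r mulrN.
Qed.

Lemma delta_mxM (R : pzSemiRingType) (n m p q : nat) (A : 'M[R]_(m, p)) (a : 'I_n) (i : 'I_m)
  (j : 'I_p) (b : 'I_q) :
  delta_mx a i *m A *m delta_mx j b = A i j *: delta_mx a b.
Proof.
apply/matrixP => k l; rewrite !mxE (bigD1 j) //= big1 ?addr0; last first.
  by move=> c /negPf cj; rewrite !mxE cj mulr0.
rewrite !mxE (bigD1 i) //= big1 ?addr0; last first.
  by move=> c /negPf cj; rewrite !mxE cj andbF mul0r.
by rewrite !mxE !eqxx andbT /=; case: (k == a); case: (l == b);
  rewrite ?mul1r ?mul0r ?mulr1 ?mulr0.
Qed.

(* D V W is the inner product of the wedges of the rows of E + (Z + V) F and
   E + (Z + W) F; it is affine in V and in W, which have a single nonzero row,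
   so that its differences at 0 are its derivatives. *)
Lemma det_mixed_difference (R : comUnitRingType) (n m : nat) (Z : 'M[R]_(n, m))
    (i j : 'I_n) (a b : 'I_m) :
  let D V W := \det (1%:M + (Z + V) *m (Z + W)^T) in
  let V := delta_mx i a in let W := delta_mx j b in let S := 1%:M + Z *m Z^T in
  S \in unitmx ->
  D 0 0 * (D V W - D V 0 - D 0 W + D 0 0) - (D V 0 - D 0 0) * (D 0 W - D 0 0) =
  D 0 0 ^+ 2 * (invmx S j i * (1%:M - Z^T *m invmx S *m Z) a b).
Proof.
move=> D V W S uS; set s := invmx S.
pose al := (Z^T *m s) a i; pose be := (s *m Z) j b; pose ka := (Z^T *m s *m Z) a b.
pose sg := s j i; pose de : R := (a == b)%:R.
have VE : V = delta_mx i 0 *m (delta_mx 0 a : 'rV_m) by rewrite mul_delta_mx.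
have WE : W^T = delta_mx b 0 *m (delta_mx 0 j : 'rV_n) by rewrite mul_delta_mx trmx_delta.
have D00 : D 0 0 = \det S by rewrite /D !addr0.
have DV0 : D V 0 = \det S * (1 + al).
  rewrite /D addr0 mulmxDl addrA -/S VE -mulmxA det_addmx // det_mx11.
  rewrite -(mulmxA (delta_mx 0 a)) delta_mxM -/s -/al.
  by rewrite 3!mxE [delta_mx _ _ _ _]mxE mulr1.
have DW0 : D 0 W = \det S * (1 + be).
  rewrite /D addr0 linearD /= mulmxDr addrA -/S WE mulmxA det_addmx // det_mx11.
  rewrite mulmxA -(mulmxA (delta_mx 0 j)) delta_mxM -/s -/be.
  by rewrite 3!mxE [delta_mx _ _ _ _]mxE mulr1.
have DVW : D V W = \det S * ((1 + al + de * sg) * (1 + be) - (ka + de * be) * sg).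
  (* The update of [S] is [V Z^T + V W^T + Z W^T]. It has rank at most two: the terms with left
     factor [e_i] are grouped, and [Z e_b e_j^T] remains. *)
  pose U : 'M[R]_(n, 1 + 1) := row_mx (delta_mx i 0) (Z *m delta_mx b 0).
  pose K : 'M[R]_(1 + 1, n) := col_mx (delta_mx 0 a *m Z^T + de *: delta_mx 0 j) (delta_mx 0 j).
  have VW : V *m W^T = de *: (delta_mx i (0 : 'I_1) *m delta_mx 0 j).
    by rewrite mul_delta_mx trmx_delta mul_delta_mx_cond /de scaler_nat.
  have -> : D V W = \det (S + U *m K).
    rewrite /D linearD /= mulmxDl !mulmxDr VW VE WE mul_row_col mulmxDr -scalemxAr.
    rewrite !mulmxA /S -!addrA; congr (\det (_ + (_ + _))).
    by rewrite addrC addrA.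
  rewrite det_addmx //; congr (_ * _).
  rewrite mul_col_mx (@scalar_mx_block _ 1 1).
  rewrite mul_col_row add_block_mx det_mx22 block_mxEul block_mxEur block_mxEdr block_mxEdl /=.
  have e1 : delta_mx 0 a *m Z^T *m s *m delta_mx i 0 = al *: delta_mx (0 : 'I_1) (0 : 'I_1).
    by rewrite -(mulmxA (delta_mx 0 a)) delta_mxM.
  have e2 : delta_mx 0 a *m Z^T *m s *m (Z *m delta_mx b 0) =
      ka *: delta_mx (0 : 'I_1) (0 : 'I_1).
    by rewrite mulmxA -(mulmxA (delta_mx 0 a)) -(mulmxA (delta_mx 0 a)) delta_mxM.
  have e3 : delta_mx 0 j *m s *m (Z *m delta_mx b 0) = be *: delta_mx (0 : 'I_1) (0 : 'I_1).
    by rewrite mulmxA -(mulmxA (delta_mx 0 j)) delta_mxM.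
  have e4 : delta_mx 0 j *m s *m delta_mx i 0 = sg *: delta_mx (0 : 'I_1) (0 : 'I_1).
    by rewrite delta_mxM.
  rewrite -/s !mulmxDl -!scalemxAl e1 e2 e3 e4 !mxE !eqxx /=.
  ring.
rewrite D00 DV0 DW0 DVW -/s -/sg.
have eD (X : 'M[R]_m) : (1%:M - X) a b = de - X a b by rewrite !mxE.
rewrite eD -/ka; ring.
Qed.

(** * Orthonormalisation and Gram determinants *)

Lemma row_mulmx_tr_ge0 (R : realDomainType) (k : nat) (v : 'rV[R]_k) : 0 <= (v *m v^T) 0 0.
Proof. by rewrite mxE sumr_ge0 // => i _; rewrite mxE -expr2 sqr_ge0. Qed.

Lemma row_mulmx_tr_eq0 (R : realDomainType) (k : nat) (v : 'rV[R]_k) :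
  ((v *m v^T) 0 0 == 0) = (v == 0).
Proof.
apply/eqP/eqP => [|->]; last by rewrite mul0mx mxE.
rewrite mxE => /eqP; rewrite psumr_eq0 => [/allP v0|i _]; last first.
  by rewrite mxE -expr2 sqr_ge0.
apply/rowP => i; have := v0 i (mem_index_enum _).
by rewrite /= !mxE -expr2 sqrf_eq0 => /eqP.
Qed.

(** The change of basis is built block upper triangular with positive diagonal, so that its
    determinant is positive and the orientation is kept. The rows below the first are treated by
    induction. *)
Lemma gram_schmidt (R : rcfType) (n k : nat) (B : 'M[R]_(n, k)) : row_free B ->
  exists2 Q, 0 < \det Q & (Q *m B) *m (Q *m B)^T = 1%:M.
Proof.
elim: n B => [|n IHn] B; first by exists 1%:M; rewrite ?det1 // [LHS]flatmx0 [RHS]flatmx0.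
rewrite -[B](@vsubmxK _ 1 n) => Bfree.
set b := usubmx _ in Bfree *; set B' := dsubmx _ in Bfree *.
have [Q' Q'0 C1] : exists2 Q, 0 < \det Q & (Q *m B') *m (Q *m B')^T = 1%:M.
  apply: IHn; have /row_freeP[A BA] := Bfree; apply/row_freeP.
  move: A BA; rewrite -[n.+1]/(1 + n)%N => A BA.
  exists (rsubmx A); have := congr1 drsubmx BA.
  rewrite mul_col_mx (@scalar_mx_block _ 1 n) block_mxKdr => <-.
  by rewrite /drsubmx col_mxKd -[in RHS](hsubmxK A) mul_mx_row row_mxKr.
set C := Q' *m B' in C1; pose b' := b - b *m C^T *m C.
have b'C : b' *m C^T = 0 by rewrite mulmxBl -(mulmxA _ C) C1 mulmx1 subrr.
(* A combination of the rows of a free matrix with first coefficient 1, hence nonzero. *)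
have b'E : b' = row_mx 1%:M (- (b *m C^T *m Q')) *m col_mx b B'.
  by rewrite mul_row_col mul1mx mulNmx -(mulmxA (b *m C^T)).
have b'0 : b' != 0.
  rewrite b'E; apply/eqP => /(congr1 (fun x => x *m pinvmx (col_mx b B'))).
  rewrite mulmxKp // mul0mx => /(congr1 lsubmx); rewrite row_mxKl linear0.
  by move=> /matrixP/(_ 0 0)/eqP; rewrite !mxE oner_eq0.
pose s := Num.sqrt ((b' *m b'^T) 0 0).
have s0 : 0 < s by rewrite sqrtr_gt0 lt_neqAle eq_sym row_mulmx_tr_eq0 b'0 row_mulmx_tr_ge0.
have ss : s * s = (b' *m b'^T) 0 0 by rewrite -expr2 sqr_sqrtr ?row_mulmx_tr_ge0.
pose Q := block_mx (s^-1)%:M (- (s^-1 *: (b *m C^T *m Q'))) 0 Q' : 'M[R]_(1 + n).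
exists Q; first by rewrite [\det _](@det_ublock _ 1 n) det_scalar1 mulr_gt0 ?invr_gt0.
have -> : Q *m col_mx b B' = col_mx (s^-1 *: b') C.
  rewrite mul_block_col mul0mx add0r mul_scalar_mx mulNmx -scalemxAl -scalerBr.
  by rewrite -[b *m _ *m _ *m _]mulmxA.
rewrite (@tr_col_mx _ 1 n) (@mul_col_row _ 1 n _ 1 n) (@scalar_mx_block _ 1 n) C1.
have -> : s^-1 *: b' *m (s^-1 *: b')^T = 1%:M.
  rewrite linearZ /= -scalemxAl -scalemxAr scalerA [b' *m _]mx11_scalar -ss.
  by rewrite scale_scalar_mx -invfM mulVf // mulf_neq0 // gt_eqF.
rewrite -scalemxAl b'C scaler0 linearZ /= -scalemxAr.
by rewrite -[C]trmxK -trmx_mul b'C trmx0 scaler0.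
Qed.

Lemma det_gram_gt0 (R : rcfType) (n k : nat) (B : 'M[R]_(n, k)) :
  row_free B -> 0 < \det (B *m B^T).
Proof.
move=> /gram_schmidt[Q Q0]; rewrite trmx_mul mulmxA -(mulmxA Q).
move=> /(congr1 (@determinant _ _)); rewrite !det_mulmx det_tr det1 => e.
have : 0 < \det Q * \det (B *m B^T) * \det Q by rewrite e ltr01.
by rewrite pmulr_lgt0 // pmulr_rgt0.
Qed.

Lemma gram_unitmx (R : rcfType) (n k : nat) (B : 'M[R]_(n, k)) :
  row_free B -> B *m B^T \in unitmx.
Proof. by move=> /det_gram_gt0 B0; rewrite unitmxE unitfE gt_eqF. Qed.

(* dh U V W is the derivative of h(V, W) in the direction U, for
   h(V, W) = tr (s V t W^T), s = (1 + Z Z^T)^-1 and t = (1 + Z^T Z)^-1. *)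
Lemma koszul_trace (R : comNzRingType) (n m : nat) (Z U V W : 'M[R]_(n, m))
    (s : 'M[R]_n) (t : 'M[R]_m) :
  s^T = s -> t^T = t -> s *m Z = Z *m t ->
  let dh U V W :=
    - \tr (s *m (U *m Z^T + Z *m U^T) *m s *m V *m t *m W^T)
    - \tr (s *m V *m t *m (U^T *m Z + Z^T *m U) *m t *m W^T) in
  dh U V W + dh V U W - dh W U V =
  - (2 * \tr (s *m (U *m Z^T *m s *m V + V *m Z^T *m s *m U) *m t *m W^T)).
Proof.
move=> sT tT sZ dh.
have Zs : Z^T *m s = t *m Z^T by rewrite -sT -trmx_mul sZ trmx_mul tT.
(* The three identities reduce the twelve traces to six, one for each order of [U], [V], [W]. The
   four that do not end in [W^T] cancel. *)
have e1 X Y Q : \tr (s *m X *m t *m Z^T *m Y *m t *m Q^T) =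
    \tr (s *m X *m Z^T *m s *m Y *m t *m Q^T).
  by rewrite -!mulmxA (mulmxA t Z^T) -Zs -!mulmxA.
have e2 X Y Q : \tr (s *m X *m t *m Y^T *m Z *m t *m Q^T) =
    \tr (s *m Q *m Z^T *m s *m Y *m t *m X^T).
  rewrite -[LHS]mxtrace_tr !trmx_mul !trmxK sT tT !mulmxA.
  by rewrite mxtrace_mulC !mulmxA e1.
have e3 X Y Q : \tr (s *m Z *m X^T *m s *m Y *m t *m Q^T) =
    \tr (s *m Y *m t *m Q^T *m Z *m t *m X^T).
  rewrite sZ (_ : _ *m Q^T = (Z *m t *m X^T) *m (s *m Y *m t *m Q^T)); last by rewrite !mulmxA.
  by rewrite mxtrace_mulC !mulmxA.
rewrite /dh !(mulmxDr, mulmxDl) !raddfD /= !mulmxA.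
rewrite (e3 U V W) (e3 V U W) (e3 W U V) (e2 V U W) (e2 U V W) (e2 U W V) (e2 V W U).
rewrite (e1 V U W) (e1 U V W) (e1 U W V).
move: (\tr (s *m U *m Z^T *m s *m V *m t *m W^T)) (\tr (s *m V *m Z^T *m s *m U *m t *m W^T))
  (\tr (s *m U *m Z^T *m s *m W *m t *m V^T)) (\tr (s *m V *m Z^T *m s *m W *m t *m U^T))
  (\tr (s *m W *m Z^T *m s *m U *m t *m V^T)) (\tr (s *m W *m Z^T *m s *m V *m t *m U^T)).
by move=> *; ring.
Qed.

Local Open Scope classical_set_scope.

(** * Differential calculus in coordinates *)

Notation pd i f := (partial (V := _^o) i f).

Section PartialDerivatives.
Variables (R : realType) (n : nat).
Implicit Types (f g : 'rV[R]_n -> R) (x : 'rV[R]_n) (i : 'I_n).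

Lemma pd_near i f g x : (\near x, f x = g x) -> pd i f x = pd i g x.
Proof. exact: near_eq_derive. Qed.

Lemma pd_cst i (c : R) x : pd i (fun=> c) x = 0.
Proof. exact: derive_cst. Qed.

Lemma pdD i f g x : differentiable f x -> differentiable g x ->
  pd i (fun y => f y + g y) x = pd i f x + pd i g x.
Proof. by move=> df dg; rewrite /partial deriveD //; apply: diff_derivable. Qed.

Lemma pdN i f x : differentiable f x -> pd i (fun y => - f y) x = - pd i f x.
Proof. by move=> df; rewrite /partial deriveN //; apply: diff_derivable. Qed.

Lemma pdM i f g x : differentiable f x -> differentiable g x ->
  pd i (fun y => f y * g y) x = pd i f x * g x + f x * pd i g x.
Proof.
move=> df dg; rewrite /partial (@deriveM _ _ f g); try exact: diff_derivable.
by rewrite addrC; congr (_ + _); exact: mulrC.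
Qed.

Lemma pdV i f x : differentiable f x -> f x != 0 ->
  pd i (fun y => (f y)^-1) x = - (f x) ^- 2 * pd i f x.
Proof. by move=> df f0; rewrite /partial deriveV //; apply: diff_derivable. Qed.

Lemma pd_sum i (I : Type) (r : seq I) (P : pred I) (F : I -> 'rV[R]_n -> R) x :
  (forall k, differentiable (F k) x) ->
  pd i (fun y => \sum_(k <- r | P k) F k y) x = \sum_(k <- r | P k) pd i (F k) x.
Proof.
move=> dF; suff [] : differentiable (fun y => \sum_(k <- r | P k) F k y) x /\
  pd i (fun y => \sum_(k <- r | P k) F k y) x = \sum_(k <- r | P k) pd i (F k) x by [].
elim: r => [|k r [IHd IHe]].
  under eq_fun do rewrite big_nil.
  by rewrite big_nil pd_cst; split=> //; apply: differentiable_cst.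
under eq_fun do rewrite big_cons; rewrite big_cons; case: (P k) => //.
by split; [apply: differentiableD|rewrite pdD ?IHe].
Qed.

Lemma differentiable_bigsum (I : Type) (r : seq I) (P : pred I) (F : I -> 'rV[R]_n -> R) x :
  (forall k, differentiable (F k) x) ->
  differentiable (fun y => \sum_(k <- r | P k) F k y) x.
Proof.
move=> dF; elim: r => [|k r IHr].
  by under eq_fun do rewrite big_nil; apply: differentiable_cst.
by under eq_fun do rewrite big_cons; case: (P k) => //; apply: differentiableD.
Qed.

End PartialDerivatives.

Lemma near_eq_differentiable (R : realType) (V W : normedModType R) (f g : V -> W) (x : V) :
  (\near x, f x = g x) -> differentiable f x -> differentiable g x.
Proof.
move=> fg df.
have gE : g \o shift x = cst (g x) + 'd f x +o_ 0 id.
  apply/eqaddoP => e e0.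
  have /eqaddoP/(_ e e0) := diff_locally df; rewrite -(nbhs_singleton fg).
  have : \forall h \near 0, f (h + x) = g (h + x).
    by move: fg; rewrite (near_shift 0 x) subr0.
  by apply: filter_app2; near=> h => fgh; rewrite /= !fctE /= fgh.
have dgf := diff_unique (diff_continuous df) gE.
by apply/diff_locallyP; rewrite dgf; split => //; apply: diff_continuous.
Unshelve. all: by end_near. Qed.

(** Scalar counterpart of [classC]: matrix entries, determinants and inverses are handled one real
    function at a time, and [smooth_scalarC] translates back. *)
Fixpoint scalarC (R : realType) (n k : nat) (U : set 'rV[R]_n)
    (f : 'rV[R]_n -> R) {struct k} : Prop :=
  if k is k'.+1 then
    (forall x, U x -> differentiable f x) /\ (forall i, scalarC k' U (pd i f))
  else forall x, U x -> {for x, continuous f}.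

Section ScalarC.
Variables (R : realType) (n : nat) (U : set 'rV[R]_n).
Hypothesis Uo : open U.
Implicit Types (f g : 'rV[R]_n -> R) (x : 'rV[R]_n) (i : 'I_n) (k : nat).

Lemma near_open (P : 'rV[R]_n -> Prop) x : U x -> (forall y, U y -> P y) -> \near x, P x.
Proof.
move=> Ux UP; have : nbhs x U by exact: open_nbhs_nbhs.
by apply: filterS.
Qed.

Lemma scalarC_continuous k f : scalarC k U f -> forall x, U x -> {for x, continuous f}.
Proof. by case: k => [//|k] Cf x Ux; apply: differentiable_continuous; apply: Cf.1. Qed.

Lemma scalarCW k f : scalarC k.+1 U f -> scalarC k U f.
Proof.
elim: k f => [|k IHk] f; first exact: scalarC_continuous.
by move=> [df pf]; split=> // i; apply: IHk.
Qed.

Lemma eq_scalarC k f g : (forall x, U x -> f x = g x) -> scalarC k U f -> scalarC k U g.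
Proof.
elim: k f g => [|k IHk] f g fg.
  move=> cf x Ux; have nfg := near_open Ux fg.
  have := cf x Ux; rewrite /prop_for /continuous_at (fg _ Ux) => fgx.
  exact: (cvg_trans (near_eq_cvg (F := nbhs x) nfg) fgx).
move=> [df pf]; split=> [x Ux|i].
  by apply: near_eq_differentiable (df _ Ux); exact: (near_open Ux fg).
by apply: IHk (pf i) => x Ux; apply: pd_near; exact: (near_open Ux fg).
Qed.

Lemma scalarC_cst k (c : R) : scalarC k U (fun=> c).
Proof.
elim: k c => [|k IHk] c; first by move=> x _; apply: cst_continuous.
split=> [x _|i]; first exact: differentiable_cst.
by apply: eq_scalarC (IHk 0) => x _; rewrite pd_cst.
Qed.

Lemma scalarCD k f g : scalarC k U f -> scalarC k U g -> scalarC k U (fun x => f x + g x).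
Proof.
elim: k f g => [|k IHk] f g.
  by move=> cf cg x Ux; exact: (cvgD (cf x Ux) (cg x Ux)).
move=> [df pf] [dg pg]; split=> [x Ux|i].
  by apply: differentiableD; [apply: df|apply: dg].
apply: eq_scalarC (IHk _ _ (pf i) (pg i)) => x Ux.
by rewrite pdD //; [apply: df|apply: dg].
Qed.

Lemma scalarCM k f g : scalarC k U f -> scalarC k U g -> scalarC k U (fun x => f x * g x).
Proof.
elim: k f g => [|k IHk] f g.
  by move=> cf cg x Ux; exact: (cvgM (cf x Ux) (cg x Ux)).
move=> Cf Cg; have [df pf] := Cf; have [dg pg] := Cg; split=> [x Ux|i].
  by apply: differentiableM; [apply: df|apply: dg].
apply: (@eq_scalarC _ (fun x => pd i f x * g x + f x * pd i g x)) => [x Ux|].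
  by rewrite pdM //; [apply: df|apply: dg].
exact: scalarCD (IHk _ _ (pf i) (scalarCW Cg)) (IHk _ _ (scalarCW Cf) (pg i)).
Qed.

Lemma scalarCN k f : scalarC k U f -> scalarC k U (fun x => - f x).
Proof.
move=> Cf; apply: (@eq_scalarC _ (fun x => -1 * f x)) => [x _|]; first by rewrite mulN1r.
by apply: scalarCM => //; apply: scalarC_cst.
Qed.

Lemma scalarC_sum k (I : Type) (r : seq I) (P : pred I) (F : I -> 'rV[R]_n -> R) :
  (forall j, scalarC k U (F j)) -> scalarC k U (fun x => \sum_(j <- r | P j) F j x).
Proof.
move=> CF; elim: r => [|j r IHr].
  by apply: eq_scalarC (scalarC_cst k 0) => x _; rewrite big_nil.
apply: (@eq_scalarC _ (fun x => (if P j then F j x else 0) + \sum_(j <- r | P j) F j x)).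
  by move=> x _; rewrite big_cons; case: (P j); rewrite ?add0r.
by apply: scalarCD => //; case: (P j) => //; apply: scalarC_cst.
Qed.

Lemma scalarC_prod k (I : Type) (r : seq I) (P : pred I) (F : I -> 'rV[R]_n -> R) :
  (forall j, scalarC k U (F j)) -> scalarC k U (fun x => \prod_(j <- r | P j) F j x).
Proof.
move=> CF; elim: r => [|j r IHr].
  by apply: eq_scalarC (scalarC_cst k 1) => x _; rewrite big_nil.
apply: (@eq_scalarC _ (fun x => (if P j then F j x else 1) * \prod_(j <- r | P j) F j x)).
  by move=> x _; rewrite big_cons; case: (P j); rewrite ?mul1r.
by apply: scalarCM => //; case: (P j) => //; apply: scalarC_cst.
Qed.

Lemma scalarCV k f : (forall x, U x -> f x != 0) ->
  scalarC k U f -> scalarC k U (fun x => (f x)^-1).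
Proof.
move=> f0; elim: k => [|k IHk] Cf.
  by move=> x Ux; exact: (cvgV (f0 x Ux) (Cf x Ux)).
have [df pf] := Cf; split=> [x Ux|i].
  by apply: differentiableV; [apply: df|apply: f0].
have CV := IHk (scalarCW Cf).
apply: (@eq_scalarC _ (fun x => - ((f x)^-1 * (f x)^-1 * pd i f x))) => [x Ux|].
  by rewrite pdV ?exprVn ?mulNr -?expr2 ?exprVn //; [apply: df|apply: f0].
exact: scalarCN (scalarCM (scalarCM CV CV) (pf i)).
Qed.

End ScalarC.

(** * Symmetry of second derivatives *)

Section SymmetricDerivatives.
Variables (R : realType) (V : normedModType R).
Implicit Types (f : V -> R) (x y u v : V).

Lemma is_derive_line f y u (s : R) : derivable f (y + s *: u) u ->
  is_derive s 1 (fun r => f (y + r *: u)) ('D_u f (y + s *: u)).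
Proof.
have e : (fun h : R => h^-1 *: (((fun r => f (y + r *: u)) \o shift s) (h *: 1)
    - f (y + s *: u))) =
  (fun h : R => h^-1 *: ((f \o shift (y + s *: u)) (h *: u) - f (y + s *: u))).
  apply/funext => h /=; congr (_ *: (f _ - _)).
  by rewrite scaler1 scalerDl addrCA.
by move=> df; split; rewrite /derivable /derive /= ?e.
Qed.

Lemma is_derive_translate f y u c : derivable f (y + c) u ->
  is_derive y u (fun z => f (z + c)) ('D_u f (y + c)).
Proof.
have e : (fun h : R => h^-1 *: (((fun z => f (z + c)) \o shift y) (h *: u) - f (y + c))) =
    (fun h : R => h^-1 *: ((f \o shift (y + c)) (h *: u) - f (y + c))).
  by apply/funext => h /=; rewrite addrA.
by move=> df; split; rewrite /derivable /derive /= ?e.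
Qed.

Lemma MVT_line f y u (t : R) : 0 < t ->
  (forall s, 0 <= s <= t -> derivable f (y + s *: u) u) ->
  exists2 s, 0 <= s <= t & f (y + t *: u) - f y = t * 'D_u f (y + s *: u).
Proof.
move=> t0 df; have dl s : 0 <= s <= t ->
    is_derive s 1 (fun r => f (y + r *: u)) ('D_u f (y + s *: u)).
  by move=> st; apply: is_derive_line; apply: df.
have [||s] := @MVT_segment R (fun r => f (y + r *: u)) (fun r => 'D_u f (y + r *: u)) 0 t (ltW t0).
- by move=> s; rewrite in_itv /= => /andP[s0 st]; apply: dl; rewrite !ltW.
- apply: derivable_within_continuous => s; rewrite in_itv /= => /dl ds.
  exact: ex_derive.
by rewrite in_itv /= scale0r addr0 subr0 => st e; exists s => //; rewrite e mulrC.
Qed.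

(** The mean value theorem is applied twice: along [u] to [z |-> f (z + t v) - f z], then along [v]
    to the resulting difference of ['D_u f]. *)
Lemma mixed_difference f x u v (r t : R) : 0 < t -> t * (`|u| + `|v|) < r ->
  (forall y, ball x r y -> derivable f y u) ->
  (forall y, ball x r y -> derivable ('D_u f) y v) ->
  exists2 y, ball x r y & f (x + t *: u + t *: v) - f (x + t *: u) - f (x + t *: v) + f x =
    t * t * 'D_v ('D_u f) y.
Proof.
move=> t0 tr du dv.
have inb a b : 0 <= a <= t -> 0 <= b <= t -> ball x r (x + a *: u + b *: v).
  move=> /andP[a0 at1] /andP[b0 bt]; rewrite -ball_normE /= opprD addrA opprD addrA subrr sub0r.
  apply: le_lt_trans tr; rewrite -opprD normrN.
  rewrite (le_trans (ler_normD _ _)) // !normrZ !ger0_norm // mulrDr lerD // ler_wpM2r //.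
have tt : 0 <= t <= t by rewrite lexx ltW.
have t00 : 0 <= (0 : R) <= t by rewrite lexx ltW.
have dphi s : 0 <= s <= t -> is_derive (x + s *: u) u (fun z => f (z + t *: v) - f z)
    ('D_u f (x + s *: u + t *: v) - 'D_u f (x + s *: u)).
  move=> st; apply: is_deriveB.
    by apply: is_derive_translate; apply/du/inb.
  by apply: derivableP; apply: du; have := inb s 0 st t00; rewrite scale0r addr0.
have [s st] : exists2 s, 0 <= s <= t & f (x + t *: u + t *: v) - f (x + t *: u) -
    (f (x + t *: v) - f x) = t * ('D_u f (x + s *: u + t *: v) - 'D_u f (x + s *: u)).
  have [|s st e] := @MVT_line (fun z => f (z + t *: v) - f z) x u t t0.
    by move=> s /dphi ds; apply: ex_derive.
  by exists s => //; rewrite e; congr (_ * _); have ds := dphi _ st; rewrite derive_val.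
have [|s' st' ->] := @MVT_line ('D_u f) (x + s *: u) v t t0.
  by move=> s' st'; apply/dv/inb.
rewrite mulrA => e; exists (x + s *: u + s' *: v); first exact: inb.
by rewrite -e; ring.
Qed.

(** Schwarz's theorem: the second difference is symmetric in [u] and [v], so each mixed derivative
    takes the same value at some point near [x], and continuity at [x] concludes. *)
Lemma symmetric_derive f x u v :
  (\near x, derivable f x u) -> (\near x, derivable f x v) ->
  (\near x, derivable ('D_u f) x v) -> (\near x, derivable ('D_v f) x u) ->
  {for x, continuous ('D_v ('D_u f))} -> {for x, continuous ('D_u ('D_v f))} ->
  'D_v ('D_u f) x = 'D_u ('D_v f) x.
Proof.
move=> du dv duv dvu cuv cvu; apply/eqP; rewrite -subr_eq0 -normr_le0.
apply/ler_addgt0Pl => e e0; rewrite addr0.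
have e2 : 0 < e / 2 by rewrite divr_gt0.
have {}cuv : \forall y \near x, `|'D_v ('D_u f) x - 'D_v ('D_u f) y| < e / 2.
  by have /cvgrPdist_lt/(_ _ e2) := cuv.
have {}cvu : \forall y \near x, `|'D_u ('D_v f) x - 'D_u ('D_v f) y| < e / 2.
  by have /cvgrPdist_lt/(_ _ e2) := cvu.
have [r /= r0 rP] : exists2 r : R, 0 < r & forall y, ball x r y ->
    [/\ derivable f y u, derivable f y v, derivable ('D_u f) y v, derivable ('D_v f) y u &
      `|'D_v ('D_u f) x - 'D_v ('D_u f) y| < e / 2 /\
      `|'D_u ('D_v f) x - 'D_u ('D_v f) y| < e / 2].
  have /nbhs_ballP[r r0 rP] : \forall y \near x, derivable f y u /\ (derivable f y v /\
      (derivable ('D_u f) y v /\ (derivable ('D_v f) y u /\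
      (`|'D_v ('D_u f) x - 'D_v ('D_u f) y| < e / 2 /\
      `|'D_u ('D_v f) x - 'D_u ('D_v f) y| < e / 2)))).
    exact: filterI du (filterI dv (filterI duv (filterI dvu (filterI cuv cvu)))).
  by exists r => // y /rP [? [? [? [? [? ?]]]]].
(* The summand 1 keeps the denominator positive when [u = v = 0] and makes the bound
   [t * (|u| + |v|) < r] strict. *)
pose t := r / (`|u| + `|v| + 1).
have N0 : 0 < `|u| + `|v| + 1 by rewrite ltr_wpDl // addr_ge0.
have t0 : 0 < t by rewrite divr_gt0.
have tr : t * (`|u| + `|v|) < r.
  by rewrite mulrAC ltr_pdivrMr // ltr_pM2l // ltrDl.
have [||y xy ey] := @mixed_difference f x u v r t t0 tr.
- by move=> y /rP[].
- by move=> y /rP[].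
have [|||z xz ez] := @mixed_difference f x v u r t t0.
- by rewrite addrC.
- by move=> z /rP[].
- by move=> z /rP[].
have yz : 'D_v ('D_u f) y = 'D_u ('D_v f) z.
  apply: (mulfI (mulf_neq0 (lt0r_neq0 t0) (lt0r_neq0 t0))).
  apply: etrans (esym ey) (etrans _ ez); rewrite (addrAC x (t *: v)).
  by congr (_ + _); exact: addrAC.
have [_ _ _ _ [hy _]] := rP _ xy; have [_ _ _ _ [_ hz]] := rP _ xz.
have -> : 'D_v ('D_u f) x - 'D_u ('D_v f) x =
    ('D_v ('D_u f) x - 'D_v ('D_u f) y) - ('D_u ('D_v f) x - 'D_u ('D_v f) z).
  by rewrite yz opprB addrA subrK.
rewrite (splitr e); apply: le_trans (ler_normB _ _) _.
exact: lerD (ltW hy) (ltW hz).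
Qed.
End SymmetricDerivatives.

Lemma scalarC_pd_sym (R : realType) (n : nat) (U : set 'rV[R]_n) (f : 'rV[R]_n -> R) i j x :
  open U -> scalarC 2 U f -> U x -> pd i (pd j f) x = pd j (pd i f) x.
Proof.
move=> Uo [df ddf] Ux; have dij k l : \near x, derivable (pd k f) x (delta_mx ord0 l).
  by apply: (near_open Uo Ux) => y Uy; apply/diff_derivable/(ddf k).1.
have dk k : \near x, derivable f x (delta_mx ord0 k).
  by apply: (near_open Uo Ux) => y Uy; apply/diff_derivable/df.
by apply: symmetric_derive => //; [exact: dij|exact: dij|
  exact: (((ddf j).2 i) x Ux)|exact: (((ddf i).2 j) x Ux)].
Qed.

(** * Entrywise calculus of matrix-valued maps *)

Definition mxpd (R : realType) (n p q : nat) (i : 'I_n) (A : 'rV[R]_n -> 'M[R]_(p, q))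
    (x : 'rV[R]_n) : 'M[R]_(p, q) := \matrix_(a, b) pd i (fun y => A y a b) x.

Definition mxdiff (R : realType) (n p q : nat) (A : 'rV[R]_n -> 'M[R]_(p, q))
    (x : 'rV[R]_n) : Prop := forall a b, differentiable (fun y => A y a b) x.

Definition mxC (R : realType) (n p q k : nat) (U : set 'rV[R]_n)
    (A : 'rV[R]_n -> 'M[R]_(p, q)) : Prop := forall a b, scalarC k U (fun y => A y a b).

Section MatrixDerivatives.
Variables (R : realType) (n : nat).
Implicit Types (x : 'rV[R]_n) (i : 'I_n).

Lemma mxpd_near p q i (A B : 'rV[R]_n -> 'M[R]_(p, q)) x : (\near x, A x = B x) ->
  mxpd i A x = mxpd i B x.
Proof.
move=> AB; apply/matrixP => a b; rewrite !mxE; apply: pd_near.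
by apply: filterS AB => y ->.
Qed.

Lemma mxdiff_cst p q (B : 'M[R]_(p, q)) x : mxdiff (fun=> B) x.
Proof. by move=> a b; apply: differentiable_cst. Qed.

Lemma mxpd_cst p q i (B : 'M[R]_(p, q)) x : mxpd i (fun=> B) x = 0.
Proof. by apply/matrixP => a b; rewrite !mxE pd_cst. Qed.

Lemma mxdiffD p q (A B : 'rV[R]_n -> 'M[R]_(p, q)) x :
  mxdiff A x -> mxdiff B x -> mxdiff (fun y => A y + B y) x.
Proof.
move=> dA dB a b; rewrite (_ : (fun y => _) = (fun y => A y a b + B y a b)).
  exact: differentiableD (dA a b) (dB a b).
by apply/funext => y; rewrite mxE.
Qed.

Lemma mxpdD p q i (A B : 'rV[R]_n -> 'M[R]_(p, q)) x : mxdiff A x -> mxdiff B x ->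
  mxpd i (fun y => A y + B y) x = mxpd i A x + mxpd i B x.
Proof.
move=> dA dB; apply/matrixP => a b; rewrite !mxE -pdD //.
by apply: (congr1 (fun f => pd i f x)); apply/funext => y; rewrite mxE.
Qed.

Lemma mxdiffN p q (A : 'rV[R]_n -> 'M[R]_(p, q)) x :
  mxdiff A x -> mxdiff (fun y => - A y) x.
Proof.
move=> dA a b; rewrite (_ : (fun y => _) = (fun y => - A y a b)).
  exact: differentiableN (dA a b).
by apply/funext => y; rewrite mxE.
Qed.

Lemma mxpdN p q i (A : 'rV[R]_n -> 'M[R]_(p, q)) x : mxdiff A x ->
  mxpd i (fun y => - A y) x = - mxpd i A x.
Proof.
move=> dA; apply/matrixP => a b; rewrite !mxE -pdN //.
by apply: (congr1 (fun f => pd i f x)); apply/funext => y; rewrite mxE.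
Qed.

Lemma mxdiff_tr p q (A : 'rV[R]_n -> 'M[R]_(p, q)) x :
  mxdiff A x -> mxdiff (fun y => (A y)^T) x.
Proof.
move=> dA a b; rewrite (_ : (fun y => _) = (fun y => A y b a)); first exact: dA.
by apply/funext => y; rewrite mxE.
Qed.

Lemma mxpd_tr p q i (A : 'rV[R]_n -> 'M[R]_(p, q)) x :
  mxpd i (fun y => (A y)^T) x = (mxpd i A x)^T.
Proof.
apply/matrixP => a b; rewrite !mxE.
by apply: (congr1 (fun f => pd i f x)); apply/funext => y; rewrite mxE.
Qed.

Lemma mxdiffM p q r (A : 'rV[R]_n -> 'M[R]_(p, q)) (B : 'rV[R]_n -> 'M[R]_(q, r)) x :
  mxdiff A x -> mxdiff B x -> mxdiff (fun y => A y *m B y) x.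
Proof.
move=> dA dB a b; rewrite (_ : (fun y => _) = (fun y => \sum_c A y a c * B y c b)).
  by apply: differentiable_bigsum => c; apply: differentiableM (dA a c) (dB c b).
by apply/funext => y; rewrite mxE.
Qed.

Lemma mxpdM p q r i (A : 'rV[R]_n -> 'M[R]_(p, q)) (B : 'rV[R]_n -> 'M[R]_(q, r)) x :
  mxdiff A x -> mxdiff B x ->
  mxpd i (fun y => A y *m B y) x = mxpd i A x *m B x + A x *m mxpd i B x.
Proof.
move=> dA dB; apply/matrixP => a b; rewrite !mxE -big_split /=.
transitivity (pd i (fun y => \sum_c A y a c * B y c b) x).
  by apply: (congr1 (fun f => pd i f x)); apply/funext => y; rewrite mxE.
rewrite pd_sum => [|c]; last exact: differentiableM (dA a c) (dB c b).
by apply: eq_bigr => c _; rewrite pdM ?mxE.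
Qed.

Lemma mxdiffZ p q (f : 'rV[R]_n -> R) (A : 'rV[R]_n -> 'M[R]_(p, q)) x :
  differentiable f x -> mxdiff A x -> mxdiff (fun y => f y *: A y) x.
Proof.
move=> df dA a b; rewrite (_ : (fun y => _) = (fun y => f y * A y a b)).
  exact: differentiableM df (dA a b).
by apply/funext => y; rewrite mxE.
Qed.

Lemma mxpdZ p q i (f : 'rV[R]_n -> R) (A : 'rV[R]_n -> 'M[R]_(p, q)) x :
  differentiable f x -> mxdiff A x ->
  mxpd i (fun y => f y *: A y) x = pd i f x *: A x + f x *: mxpd i A x.
Proof.
move=> df dA; apply/matrixP => a b; rewrite !mxE -pdM //.
by apply: (congr1 (fun f => pd i f x)); apply/funext => y; rewrite mxE.
Qed.

(** Comes from differentiating [A *m invmx A = 1]. Differentiability of the inverse is assumed here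
    and supplied later by [mxC_inv]. *)
Lemma mxpd_inv p i (A : 'rV[R]_n -> 'M[R]_p) x :
  (\near x, A x \in unitmx) -> mxdiff A x -> mxdiff (fun y => invmx (A y)) x ->
  mxpd i (fun y => invmx (A y)) x = - (invmx (A x) *m mxpd i A x *m invmx (A x)).
Proof.
move=> uA dA dV; have uAx := nbhs_singleton uA.
have : mxpd i (fun y => A y *m invmx (A y)) x = 0.
  by rewrite -(mxpd_cst i (1%:M : 'M[R]_p) x); apply: mxpd_near; apply: filterS uA => y /mulmxV.
rewrite mxpdM // => /eqP; rewrite addrC addr_eq0 => /eqP e.
by rewrite -[LHS](mulKmx uAx) e mulmxN mulmxA.
Qed.

Variable U : set 'rV[R]_n.
Hypothesis Uo : open U.

Lemma mxC_mxdiff p q k (A : 'rV[R]_n -> 'M[R]_(p, q)) x : mxC k.+1 U A -> U x -> mxdiff A x.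
Proof. by move=> CA Ux a b; apply: (CA a b).1. Qed.

Lemma mxC_pd p q k (A : 'rV[R]_n -> 'M[R]_(p, q)) i : mxC k.+1 U A -> mxC k U (mxpd i A).
Proof.
move=> CA a b; apply: (eq_scalarC Uo) ((CA a b).2 i) => y _.
by rewrite mxE.
Qed.

Lemma mxC_cst p q k (B : 'M[R]_(p, q)) : mxC k U (fun=> B).
Proof. by move=> a b; apply: scalarC_cst. Qed.

Lemma mxCD p q k (A B : 'rV[R]_n -> 'M[R]_(p, q)) :
  mxC k U A -> mxC k U B -> mxC k U (fun y => A y + B y).
Proof.
move=> CA CB a b; apply: (eq_scalarC Uo) (scalarCD Uo (CA a b) (CB a b)) => y _.
by rewrite mxE.
Qed.

Lemma mxC_tr p q k (A : 'rV[R]_n -> 'M[R]_(p, q)) : mxC k U A -> mxC k U (fun y => (A y)^T).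
Proof. by move=> CA a b; apply: (eq_scalarC Uo) (CA b a) => y _; rewrite mxE. Qed.

Lemma mxCM p q r k (A : 'rV[R]_n -> 'M[R]_(p, q)) (B : 'rV[R]_n -> 'M[R]_(q, r)) :
  mxC k U A -> mxC k U B -> mxC k U (fun y => A y *m B y).
Proof.
move=> CA CB a b; apply: (@eq_scalarC _ _ _ Uo _ (fun y => \sum_c A y a c * B y c b)).
  by move=> y _; rewrite mxE.
by apply: scalarC_sum => // c; apply: (scalarCM Uo) (CA a c) (CB c b).
Qed.

Lemma scalarC_det p k (A : 'rV[R]_n -> 'M[R]_p) : mxC k U A -> scalarC k U (fun y => \det (A y)).
Proof.
move=> CA; apply: scalarC_sum => // s; apply: scalarCM => //; first exact: scalarC_cst.
by apply: scalarC_prod => // a; apply: CA.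
Qed.

Lemma mxC_inv p k (A : 'rV[R]_n -> 'M[R]_p) : (forall x, U x -> A x \in unitmx) ->
  mxC k U A -> mxC k U (fun y => invmx (A y)).
Proof.
move=> uA CA a b.
(* Cramer's rule: the entries of the inverse are polynomials in the entries of [A y] divided by its
   determinant. *)
apply: (@eq_scalarC _ _ _ Uo _ (fun y => (\det (A y))^-1 * cofactor (A y) b a)).
  by move=> y Uy; rewrite /invmx uA // !mxE.
apply: scalarCM => //.
  by apply: scalarCV => //; [move=> y /uA; rewrite unitmxE unitfE|apply: scalarC_det].
apply: scalarCM => //; first exact: scalarC_cst.
apply: scalarC_det => c d; apply: (eq_scalarC Uo) (CA (lift b c) (lift a d)) => y _.
by rewrite !mxE.
Qed.

Lemma mxpd_sym p q (A : 'rV[R]_n -> 'M[R]_(p, q)) i j x : mxC 2 U A -> U x ->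
  mxpd i (mxpd j A) x = mxpd j (mxpd i A) x.
Proof.
move=> CA Ux; apply/matrixP => a b; rewrite [LHS]mxE [RHS]mxE.
transitivity (pd i (pd j (fun y => A y a b)) x).
  by apply: (congr1 (fun f => pd i f x)); apply/funext => y; rewrite mxE.
rewrite (scalarC_pd_sym _ _ Uo (CA a b) Ux).
by apply: (congr1 (fun f => pd j f x)); apply/funext => y; rewrite mxE.
Qed.

End MatrixDerivatives.

(** * Row-vector maps and their Jacobian matrices *)

Section RowMaps.
Variables (R : realType) (n l : nat).
Implicit Types (f : 'rV[R]_n -> 'rV[R]_l) (x : 'rV[R]_n) (i : 'I_n) (j : 'I_l).

Lemma differentiable_rowP f x : differentiable f x <->
  forall j, differentiable (fun y => f y ord0 j) x.
Proof.
split=> [df j|df].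
  exact: (@differentiable_comp _ _ _ _ f (fun v : 'rV[R]_l => v ord0 j) x df
    (differentiable_coord _ _ _)).
rewrite (_ : f = \sum_(j < l) (fun y => f y ord0 j *: (delta_mx ord0 j : 'rV[R]_l))).
  by apply: differentiable_sum => j; apply: differentiableZl.
by apply/funext => y; rewrite [LHS]row_sum_delta fct_sumE.
Qed.

Lemma partial_coord f x i j : differentiable f x ->
  partial i f x ord0 j = pd i (fun y => f y ord0 j) x.
Proof. by move=> df; rewrite /partial derive_mx ?mxE //; apply: diff_derivable. Qed.

Lemma jacobian_coord f x i j : differentiable f x ->
  'J f x i j = pd i (fun y => f y ord0 j) x.
Proof.
by move=> df; rewrite -partial_coord // /partial deriveE // mxE.
Qed.

Lemma jacobian_row f x i : differentiable f x -> row i ('J f x) = partial i f x.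
Proof. by move=> df; rewrite /partial deriveEjacobian // rowE. Qed.

Lemma jacobian_near f g x : (\near x, f x = g x) -> differentiable f x -> 'J f x = 'J g x.
Proof.
move=> fg df; have dg := near_eq_differentiable fg df.
apply/row_matrixP => i; apply: etrans (jacobian_row i df) _.
by apply: etrans _ (esym (jacobian_row i dg)); exact: near_eq_derive.
Qed.

Lemma classC_scalarC k (U : set 'rV[R]_n) f j : open U ->
  classC k U f -> scalarC k U (fun y => f y ord0 j).
Proof.
move=> Uo; elim: k f => [|k IHk] f.
  move=> cf x Ux; apply: (@continuous_comp _ _ _ f (fun v : 'rV[R]_l => v ord0 j) x (cf x Ux)).
  exact: coord_continuous.
move=> [df pf]; split=> [x /df/differentiable_rowP //|i].
by apply: (eq_scalarC Uo) (IHk _ (pf i)) => x /df dfx; rewrite partial_coord.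
Qed.

(** One order is spent to obtain continuity of the vector map from differentiability of its
    coordinates. This is harmless for [smooth], which quantifies over all orders. *)
Lemma scalarC_classC k (U : set 'rV[R]_n) f : open U ->
  (forall j, scalarC k.+1 U (fun y => f y ord0 j)) -> classC k U f.
Proof.
move=> Uo; elim: k f => [|k IHk] f Cf.
  move=> x Ux; apply: differentiable_continuous; apply/differentiable_rowP => j.
  exact: (Cf j).1.
have df x : U x -> differentiable f x.
  by move=> Ux; apply/differentiable_rowP => j; apply: (Cf j).1.
split=> // i; apply: IHk => j.
apply: (@eq_scalarC _ _ _ Uo _ (pd i (fun y => f y ord0 j))); last exact: (Cf j).2.
by move=> x /df dfx; rewrite partial_coord.
Qed.

Lemma smooth_scalarC (U : set 'rV[R]_n) f : open U ->
  smooth U f <-> forall k j, scalarC k U (fun y => f y ord0 j).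
Proof.
move=> Uo; split=> [sf k j|sf k]; first exact: classC_scalarC.
by apply: scalarC_classC => // j; apply: sf.
Qed.

Lemma smooth_jacobian (U : set 'rV[R]_n) f k : open U -> smooth U f ->
  mxC k U (fun x => 'J f x).
Proof.
move=> Uo sf i j; have [df _] := sf 1%N.
apply: (@eq_scalarC _ _ _ Uo _ (pd i (fun y => f y ord0 j))) => [x /df dfx|].
  by rewrite jacobian_coord.
by have := (smooth_scalarC f Uo).1 sf k.+1 j; case=> _; apply.
Qed.

End RowMaps.

(** * Graph charts of the Grassmannian *)

Section OrientedPlanes.
Variables (R : realType) (n k : nat).
Implicit Types (P : oriented_grassmannian R n k) (B C : 'M[R]_(n, k)).

Lemma positive_basis_free P B : positive_basis P B -> row_free B.
Proof.
rewrite /positive_basis; case: P => S /= [B0 B0free ->] [Q /= Q0 <-].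
by rewrite /row_free mxrankMfree // -/(row_free Q) row_free_unit unitmxE unitfE gt_eqF.
Qed.

Lemma positive_basisP P B C : positive_basis P B ->
  (positive_basis P C <-> exists2 Q, 0 < \det Q & C = Q *m B).
Proof.
rewrite /positive_basis; case: P => S /= [B0 B0free ->] [Q /= Q0 <-].
split=> [[Q' /= Q'0 <-]|[Q' Q'0 ->]].
  have uQ : Q \in unitmx by rewrite unitmxE unitfE gt_eqF.
  exists (Q' *m invmx Q); first by rewrite det_mulmx det_inv divr_gt0.
  by rewrite mulmxA mulmxKV.
by exists (Q' *m Q); rewrite ?mulmxA //= det_mulmx mulr_gt0.
Qed.

Lemma dot_mulmx (u v : 'rV[R]_k) : dot u v = (u *m v^T) ord0 ord0.
Proof. by rewrite /dot mxE; apply: eq_bigr => i _; rewrite mxE. Qed.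

Lemma wedge_mulmx (Q : 'M[R]_n) B : wedge (Q *m B) = \det Q *: wedge B.
Proof. by apply/rowP => s; rewrite !mxE -det_mulmx mulmx_colsub. Qed.

Lemma dot_wedge B C : dot (wedge B) (wedge C) = \det (B *m C^T).
Proof.
pose G (s : multi_index n k) := \det (colsub (val s) B) * \det (colsub (val s) C).
rewrite cauchy_binet (eq_bigl (mem {: multi_index n k})) // (big_enum_val G).
by apply: eq_bigr => s _; rewrite !mxE.
Qed.

(** [plucker] chooses some orthonormal positive basis. Two positive bases differ by a factor of
    positive determinant, so any of them gives the same vector once divided by the norm of its
    wedge, the square root of the Gram determinant. *)
Lemma plucker_wedge P B : positive_basis P B ->
  plucker P = (Num.sqrt (\det (B *m B^T)))^-1 *: wedge B.
Proof.
move=> PB; have B0 := det_gram_gt0 (positive_basis_free PB).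
rewrite /plucker; set C := xget _ _.
have [PC C1] : positive_basis P C /\ C *m C^T = 1%:M.
  have [Q Q0 QB1] := gram_schmidt (positive_basis_free PB).
  apply: (@xgetPex _ 0 [set B | positive_basis P B /\ B *m B^T = 1%:M]).
  by exists (Q *m B); split=> //; apply/(positive_basisP _ PB); exists Q.
have [Q Q0 CQ] := (positive_basisP C PB).1 PC.
rewrite CQ wedge_mulmx; congr (_ *: _).
have : \det Q ^+ 2 * \det (B *m B^T) = 1.
  rewrite -(det1 _ n) -C1 CQ trmx_mul mulmxA -(mulmxA Q) !det_mulmx det_tr; ring.
move=> /(congr1 Num.sqrt); rewrite sqrtrM ?sqr_ge0 // sqrtr_sqr ger0_norm ?ltW // sqrtr1.
move=> e; rewrite -[LHS](mulfK (_ : Num.sqrt (\det (B *m B^T)) != 0)) ?e ?mul1r //.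
by rewrite gt_eqF ?sqrtr_gt0.
Qed.

End OrientedPlanes.

Section Frames.
Variables (R : realType) (n m : nat) (E : 'M[R]_(n, m + n)) (F : 'M[R]_(m, m + n)).
Hypotheses (EE : E *m E^T = 1%:M) (EF : E *m F^T = 0) (FF : F *m F^T = 1%:M).
Implicit Types (Z : 'M[R]_(n, m)) (B : 'M[R]_(n, m + n)).

Lemma frame_tr : F *m E^T = 0.
Proof. by rewrite -[F]trmxK -trmx_mul EF trmx0. Qed.

Lemma frame_complete : E^T *m E + F^T *m F = 1%:M.
Proof.
(* With [F] on top the stacked matrix is square of size [m + n]; being a one-sided inverse, its
   transpose is a two-sided one. *)
have : col_mx F E *m (col_mx F E)^T = 1%:M.
  by rewrite tr_col_mx mul_col_row EE FF EF frame_tr -scalar_mx_block.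
by move=> /mulmx1C; rewrite tr_col_mx mul_row_col addrC.
Qed.

Lemma graph_mulE Z : (E + Z *m F) *m E^T = 1%:M.
Proof. by rewrite mulmxDl EE -mulmxA frame_tr mulmx0 addr0. Qed.

Lemma graph_mulF Z : (E + Z *m F) *m F^T = Z.
Proof. by rewrite mulmxDl EF -mulmxA FF mulmx1 add0r. Qed.

Lemma graph_gram Z W : (E + Z *m F) *m (E + W *m F)^T = 1%:M + Z *m W^T.
Proof. by rewrite linearD /= trmx_mul mulmxDr graph_mulE mulmxA graph_mulF. Qed.

Lemma graph_free Z : row_free (E + Z *m F).
Proof. by apply/row_freeP; exists E^T; apply: graph_mulE. Qed.

(** Inserting [E^T E + F^T F = 1] gives [B = (B E^T) E + (B F^T) F]; the first coefficient is then
    factored out. *)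
Lemma graph_decomp B : B *m E^T \in unitmx ->
  B = (B *m E^T) *m (E + (invmx (B *m E^T) *m (B *m F^T)) *m F).
Proof.
move=> uBE; rewrite mulmxDr mulmxA mulKVmx // -!mulmxA -mulmxDr.
by rewrite frame_complete mulmx1.
Qed.

(** A graph basis has [B E^T = 1], so in general [B E^T] is the change of basis. Its determinant
    must be positive, not just nonzero, because the planes are oriented. *)
Lemma graph_chart_dom P B : positive_basis P B ->
  dom (graph_chart E F) P <-> 0 < \det (B *m E^T).
Proof.
move=> PB; split=> [[z /= Pz]|BE0].
  have [Q Q0 ->] := (positive_basisP B Pz).1 PB.
  by rewrite -mulmxA graph_mulE mulmx1.
have uBE : B *m E^T \in unitmx by rewrite unitmxE unitfE gt_eqF.
exists (mxvec (invmx (B *m E^T) *m (B *m F^T))); rewrite /= mxvecK.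
apply/(positive_basisP _ PB); exists (invmx (B *m E^T)).
  by rewrite det_inv invr_gt0.
by rewrite -[LHS](mulKmx uBE) -(graph_decomp uBE).
Qed.

Lemma graph_chart_coord P B : positive_basis P B -> 0 < \det (B *m E^T) ->
  coord (graph_chart E F) P = mxvec (invmx (B *m E^T) *m (B *m F^T)).
Proof.
move=> PB BE0; have uBE : B *m E^T \in unitmx by rewrite unitmxE unitfE gt_eqF.
have coordE z : positive_basis P (E + vec_mx z *m F) ->
    z = mxvec (invmx (B *m E^T) *m (B *m F^T)).
  move=> Pz; have [Q Q0 BQ] := (positive_basisP B Pz).1 PB.
  have QE : B *m E^T = Q by rewrite BQ -mulmxA graph_mulE mulmx1.
  rewrite QE {1}BQ -[Q *m _ *m _]mulmxA graph_mulF mulKmx ?vec_mxK //.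
  by rewrite -QE.
apply: xget_unique => //=; have [z Pz] := (graph_chart_dom PB).2 BE0.
by rewrite -(coordE _ Pz).
Qed.

Lemma graph_chart_plucker z : plucker (param (graph_chart E F) z) =
  (Num.sqrt (\det (1%:M + vec_mx z *m (vec_mx z)^T)))^-1 *: wedge (E + vec_mx z *m F).
Proof. by rewrite /= (plucker_wedge (positive_basis_span (graph_free _))) graph_gram. Qed.

End Frames.

(** * The Plucker metric in a graph chart *)

Lemma derive_affine (R : realType) (V W : normedModType R) (f : V -> W) (x v : V) (d : W) :
  (forall h : R, f (h *: v + x) = f x + h *: d) -> 'D_v f x = d.
Proof.
move=> fd; rewrite /derive; apply: cvg_lim => //; apply: cvg_near_cst.
have : \forall h \near 0^', h != 0 :> R by exact: nbhs_dnbhs_neq.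
apply: filterS => h h0 /=.
by rewrite fd addrC addKr scalerA mulVf // scale1r.
Qed.

Lemma scalarC_coord (R : realType) (n k : nat) (U : set 'rV[R]_n) (j : 'I_n) : open U ->
  scalarC k U (fun x => x ord0 j).
Proof.
move=> Uo; case: k => [|k]; first by move=> x _; apply: coord_continuous.
split=> [x _|i]; first exact: differentiable_coord.
apply: (@eq_scalarC _ _ _ Uo _ (fun=> (delta_mx ord0 i : 'rV[R]_n) ord0 j)); last first.
  exact: scalarC_cst.
move=> x _; rewrite /partial (@derive_affine _ _ _ _ _ _ ((delta_mx ord0 i : 'rV[R]_n) ord0 j)) //.
by move=> h; rewrite !mxE addrC.
Qed.

Lemma mxC_vec_mx (R : realType) (n m k : nat) (U : set 'rV[R]_(n * m)) : open U ->
  mxC k U (fun z => vec_mx z : 'M[R]_(n, m)).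
Proof.
move=> Uo i a; apply: (eq_scalarC Uo) (scalarC_coord k (mxvec_index i a) Uo) => z _.
by rewrite -[in LHS](vec_mxK z) mxvecE.
Qed.

Lemma mxpd_vec_mx (R : realType) (n m : nat) (i : 'I_(n * m)) z :
  mxpd i (fun z => vec_mx z : 'M[R]_(n, m)) z = vec_mx (delta_mx ord0 i).
Proof.
apply/matrixP => a b; rewrite mxE; apply: derive_affine => h.
by rewrite linearD linearZ /= addrC !mxE.
Qed.

(** Only row [i] of [D] can be nonzero, and row [i] of [A + h D] is the combination of those of [A]
    and [A + D] with weights [1 - h] and [h]. *)
Lemma det_row_affine (R : comNzRingType) (n : nat) (A D : 'M[R]_n) (i : 'I_n) (h : R) :
  row' i D = 0 -> \det (A + h *: D) = \det A + h * (\det (A + D) - \det A).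
Proof.
move=> D0; rewrite (@determinant_multilinear _ _ _ A (A + D) i (1 - h) h).
- by ring.
- by rewrite !linearD linearZ /= scalerBl scale1r addrA subrK.
- by rewrite linearD linearZ /= D0 scaler0 addr0.
- by rewrite !linearD linearZ /= D0 scaler0.
Qed.

Lemma jacobian_mxpd (R : realType) (n l : nat) (f : 'rV[R]_n -> 'rV[R]_l) x i :
  differentiable f x -> row i ('J f x) = mxpd i f x.
Proof.
move=> df; apply/rowP => j; rewrite (jacobian_row i df) partial_coord // mxE.
by apply: (congr1 (fun g => pd i g x)); apply/funext => y; rewrite [ord0]ord1.
Qed.

Lemma mxdiff_row (R : realType) (n l : nat) (f : 'rV[R]_n -> 'rV[R]_l) x :
  mxdiff f x <-> differentiable f x.
Proof.
split=> [df|/differentiable_rowP df a b]; first by apply/differentiable_rowP => j; apply: df.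
by rewrite (ord1 a).
Qed.

Lemma dotC (R : realType) (n : nat) (u v : 'rV[R]_n) : dot u v = dot v u.
Proof. by apply: eq_bigr => i _; rewrite mulrC. Qed.

Section NormalizedDot.
Variables (R : realType) (n l : nat) (w : 'rV[R]_n -> 'rV[R]_l) (z : 'rV[R]_n).
Hypotheses (dw : mxdiff w z) (w0 : 0 < dot (w z) (w z)).

Lemma differentiable_dot : differentiable (fun y => dot (w y) (w y)) z.
Proof.
rewrite (_ : (fun y => _) = (fun y => (w y *m (w y)^T) ord0 ord0)); last first.
  by apply/funext => y; rewrite dot_mulmx.
exact: (mxdiffM dw (mxdiff_tr dw)).
Qed.

Lemma pd_dot i : pd i (fun y => dot (w y) (w y)) z = 2 * dot (w z) (mxpd i w z).
Proof.
transitivity (mxpd i (fun y => w y *m (w y)^T) z ord0 ord0).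
  rewrite mxE; apply: (congr1 (fun g => pd i g z)).
  by apply/funext => y; rewrite dot_mulmx.
rewrite (mxpdM _ dw (mxdiff_tr dw)) mxpd_tr mxE -!dot_mulmx.
by rewrite (dotC (mxpd i w z)); ring.
Qed.

Lemma differentiable_invsqrt_dot :
  differentiable (fun y => (Num.sqrt (dot (w y) (w y)))^-1) z.
Proof.
apply: differentiableV; last by rewrite gt_eqF // sqrtr_gt0.
apply: (@differentiable_comp _ _ _ _ (fun y => dot (w y) (w y)) (@Num.sqrt R)).
  exact: differentiable_dot.
by apply/derivable1_diffP; have := is_derive1_sqrt w0; case.
Qed.

Lemma pd_invsqrt_dot i : pd i (fun y => (Num.sqrt (dot (w y) (w y)))^-1) z =
  - (Num.sqrt (dot (w z) (w z)))^-1 * dot (w z) (mxpd i w z) / dot (w z) (w z).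
Proof.
set r := fun y => _; set d := dot (w z) (w z).
(* Differentiating this identity gives the derivative of the inverse norm without differentiating
   the square root explicitly. *)
have rr : (\near z, r z * r z * dot (w z) (w z) = 1).
  have wgt : \near z, 0 < dot (w z) (w z).
    exact: (cvgr_gt _ (differentiable_continuous differentiable_dot) _ w0).
  apply: filterS wgt => y wy.
  by rewrite /r -invfM -expr2 sqr_sqrtr ?mulVf ?gt_eqF // ltW.
have dr : differentiable r z := differentiable_invsqrt_dot.
have dd := differentiable_dot.
have : pd i (fun y => r y * r y * dot (w y) (w y)) z = 0.
  by rewrite -(pd_cst i 1 z); apply: pd_near.
rewrite pdM //; last exact: differentiableM.
rewrite pdM // pd_dot -/d => e.
have r0 : r z != 0 by rewrite /r invr_eq0 gt_eqF // sqrtr_gt0.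
have d0 : d != 0 by rewrite gt_eqF.
have {}e : r z * (pd i r z * d + r z * dot (w z) (mxpd i w z)) = 0 by lra.
move/eqP: e; rewrite mulf_eq0 (negPf r0) /= addr_eq0 => /eqP e.
by rewrite -[LHS](mulfK d0) e; congr (_ / _); rewrite /r; ring.
Qed.

(** The derivative of a normalised vector is the component of the derivative orthogonal to [w],
    divided by the norm of [w]; this gives a Fubini-Study type formula. *)
Lemma dot_normalized i j :
  let f y := (Num.sqrt (dot (w y) (w y)))^-1 *: w y in
  dot (row i ('J f z)) (row j ('J f z)) =
  (dot (w z) (w z) * dot (mxpd i w z) (mxpd j w z)
   - dot (w z) (mxpd i w z) * dot (w z) (mxpd j w z)) / dot (w z) (w z) ^+ 2.
Proof.
set d := dot (w z) (w z) => f; pose r y := (Num.sqrt (dot (w y) (w y)))^-1.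
have dr := differentiable_invsqrt_dot.
have d0 : d != 0 by rewrite gt_eqF.
have rr : r z ^+ 2 = d^-1 by rewrite exprVn sqr_sqrtr // ltW.
have df : differentiable f z by apply/mxdiff_row; apply: mxdiffZ.
have fE a : row a ('J f z) = r z *: (mxpd a w z - (dot (w z) (mxpd a w z) / d) *: w z).
  rewrite (jacobian_mxpd _ df) (mxpdZ _ dr dw) pd_invsqrt_dot scalerBr scalerA addrC.
  by rewrite -/(r z) -/d !mulNr scaleNr mulrA.
rewrite !fE; have dotE (a b : R) (u v : 'rV[R]_l) :
    dot (r z *: (u - a *: w z)) (r z *: (v - b *: w z)) =
    r z ^+ 2 * (dot u v - b * dot (w z) u - a * dot (w z) v + a * b * d).
  rewrite /d /dot !mulr_sumr -!sumrB -big_split /= mulr_sumr.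
  by apply: eq_bigr => c _; rewrite !mxE; ring.
rewrite dotE rr; move: (dot (mxpd i w z) (mxpd j w z)) (dot (w z) (mxpd i w z))
  (dot (w z) (mxpd j w z)) => c p q; by field.
Qed.
End NormalizedDot.

Section GraphMetric.
Variables (R : realType) (n m : nat).
Implicit Types Z : 'M[R]_(n, m).

Lemma graph_gram_unitmx Z : 1%:M + Z *m Z^T \in unitmx.
Proof.
have := @gram_unitmx R n (n + m) (row_mx 1%:M Z).
rewrite tr_row_mx mul_row_col trmx1 mulmx1; apply.
by apply/row_freeP; exists (col_mx 1%:M 0); rewrite mul_row_col mulmx1 mulmx0 addr0.
Qed.

Lemma graph_cogram_unitmx Z : 1%:M + Z^T *m Z \in unitmx.
Proof. by rewrite unitmxE det_addM -unitmxE graph_gram_unitmx. Qed.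

(** A Woodbury identity, based on [T Z^T = Z^T S]. It identifies the second factor found in
    [det_mixed_difference] as [T^-1]. *)
Lemma invmx_graph_cogram Z :
  invmx (1%:M + Z^T *m Z) = 1%:M - Z^T *m invmx (1%:M + Z *m Z^T) *m Z.
Proof.
set S := 1%:M + Z *m Z^T; set T := 1%:M + Z^T *m Z.
have uS : S \in unitmx := graph_gram_unitmx Z.
have uT : T \in unitmx := graph_cogram_unitmx Z.
rewrite -[RHS](mulKmx uT) -[LHS]mulmx1; congr (_ *m _).
have TZ : T *m Z^T = Z^T *m S by rewrite mulmxDl mulmxDr mul1mx mulmx1 mulmxA.
by rewrite mulmxBr mulmx1 !mulmxA TZ -(mulmxA Z^T) mulmxV // mulmx1 addrK.
Qed.

Lemma mxtrace_delta (s : 'M[R]_n) (t : 'M[R]_m) i j a b :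
  \tr (s *m delta_mx i a *m t *m (delta_mx j b)^T) = s j i * t a b.
Proof.
rewrite trmx_delta mxtrace_mulC !mulmxA delta_mxM -scalemxAl linearZ /=; congr (_ * _).
rewrite -(mul_delta_mx (0 : 'I_1)) -mulmxA mxtrace_mulC delta_mxM linearZ /=.
by rewrite trace_mx11 mxE !eqxx mulr1.
Qed.

Lemma vec_mxD_delta (z : 'rV[R]_(n * m)) i a :
  vec_mx (z + delta_mx ord0 (mxvec_index i a)) = vec_mx z + delta_mx i a.
Proof. by rewrite -(vec_mx_delta _ i a); apply/matrixP => k l; rewrite !mxE. Qed.

Variables (E : 'M[R]_(n, m + n)) (F : 'M[R]_(m, m + n)).
Hypotheses (EE : E *m E^T = 1%:M) (EF : E *m F^T = 0) (FF : F *m F^T = 1%:M).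

Let w (z : 'rV[R]_(n * m)) := wedge (E + vec_mx z *m F).

(* A coordinate direction moves a single row of the basis. *)
Let wD (a : 'I_(n * m)) z (h : R) :
  w (h *: delta_mx ord0 a + z) = w z + h *: (w (z + delta_mx ord0 a) - w z).
Proof.
apply/rowP => s; rewrite !mxE /w.
case/mxvec_indexP: a => i b; set g := val (enum_val s).
set D := colsub g (delta_mx i b *m F).
have -> : colsub g (E + vec_mx (h *: delta_mx ord0 (mxvec_index i b) + z) *m F) =
    colsub g (E + vec_mx z *m F) + h *: D.
  have -> : vec_mx (h *: delta_mx ord0 (mxvec_index i b) + z) = vec_mx z + h *: delta_mx i b.
    by rewrite -(vec_mx_delta _ i b); apply/matrixP => k l; rewrite !mxE addrC.
  by apply/matrixP => k l; rewrite mulmxDl -scalemxAl addrA !mxE.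
have -> : colsub g (E + vec_mx (z + delta_mx ord0 (mxvec_index i b)) *m F) =
    colsub g (E + vec_mx z *m F) + D.
  rewrite vec_mxD_delta mulmxDl addrA.
  by apply/matrixP => k l; rewrite !mxE.
apply: (@det_row_affine _ _ _ _ i); apply/matrixP => k l; rewrite !mxE big1 // => c _.
by have := neq_lift i k; rewrite eq_sym => /negPf ik; rewrite !mxE ik mul0r.
Qed.

Let dw z : mxdiff w z.
Proof.
have CS : mxC 1 setT (fun z => E + vec_mx z *m F).
  apply: mxCD; [exact: openT|apply: mxC_cst; exact: openT|].
  by apply: mxCM; [exact: openT|apply: mxC_vec_mx; exact: openT|apply: mxC_cst; exact: openT].
move=> r s; rewrite (_ : (fun y => _) =
  (fun y => \det (colsub (val (enum_val s)) (E + vec_mx y *m F)))); last first.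
  by apply/funext => y; rewrite mxE.
suff : scalarC 1 setT (fun y => \det (colsub (val (enum_val s)) (E + vec_mx y *m F))).
  by case=> + _; apply.
apply: scalarC_det; first exact: openT.
move=> i j; apply: (@eq_scalarC _ _ _ openT _ _ _ _ (CS i (val (enum_val s) j))) => y _.
by rewrite !mxE.
Qed.

Let w_pd a z : mxpd a w z = w (z + delta_mx ord0 a) - w z.
Proof.
rewrite -jacobian_mxpd; last exact/mxdiff_row.
by rewrite jacobian_row; [apply: derive_affine; exact: wD|apply/mxdiff_row].
Qed.

Let dotw y z : dot (w y) (w z) = \det (1%:M + vec_mx y *m (vec_mx z)^T).
Proof. by rewrite /w dot_wedge graph_gram. Qed.

(** By [w_pd] the derivatives of the wedge are differences between neighbouring points, so the
    numerator of [dot_normalized] is the left side of [det_mixed_difference], with [D 0 0] the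
    squared norm. For matrices with a single entry 1, the product of the two matrix entries is the
    trace. *)
Theorem grassmannian_metricE (z : 'rV[R]_(n * m)) (a b : 'I_(n * m)) :
  let Z : 'M[R]_(n, m) := vec_mx z in
  grassmannian_metric (graph_chart E F) z a b =
  \tr (invmx (1%:M + Z *m Z^T) *m vec_mx (delta_mx ord0 a) *m
       invmx (1%:M + Z^T *m Z) *m (vec_mx (delta_mx ord0 b))^T).
Proof.
move=> Z; have uS := graph_gram_unitmx Z.
have S0 : 0 < dot (w z) (w z) by rewrite dot_wedge det_gram_gt0 // graph_free.
rewrite /grassmannian_metric /induced_metric mxE.
have -> : @plucker R n (m + n) \o param (graph_chart E F) =
    (fun y => (Num.sqrt (dot (w y) (w y)))^-1 *: w y).
  by apply/funext => y /=; rewrite graph_chart_plucker // dotw.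
rewrite (dot_normalized (dw z) S0) !w_pd.
case/mxvec_indexP: a => i a; case/mxvec_indexP: b => j b.
rewrite !vec_mx_delta mxtrace_delta invmx_graph_cogram.
have := det_mixed_difference i j a b uS.
rewrite /=; set za := z + delta_mx ord0 (mxvec_index i a).
set zb := z + delta_mx ord0 (mxvec_index j b).
have Za : vec_mx za = Z + delta_mx i a by exact: vec_mxD_delta.
have Zb : vec_mx zb = Z + delta_mx j b by exact: vec_mxD_delta.
rewrite -Za -Zb addr0 -!dotw => e.
apply: (canLR (mulfK _)); first by rewrite expf_neq0 // gt_eqF.
rewrite [RHS]mulrC -e.
have dotBB (u v x y : 'rV[R]_#|{: multi_index n (m + n)}|) :
    dot (u - x) (v - y) = dot u v - dot u y - dot x v + dot x y.
  rewrite /dot -!sumrB -big_split; apply: eq_bigr => c _; rewrite !mxE /=; ring.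
have dotB (u v x : 'rV[R]_#|{: multi_index n (m + n)}|) : dot u (v - x) = dot u v - dot u x.
  by rewrite /dot -sumrB; apply: eq_bigr => c _; rewrite !mxE /=; ring.
rewrite dotBB !dotB (dotC (w za) (w z)).
move: (dot _ _) (dot _ _) => ? ?; ring.
Qed.

End GraphMetric.

Lemma pd_mxtrace (R : realType) (n p : nat) i (A : 'rV[R]_n -> 'M[R]_p) x : mxdiff A x ->
  pd i (fun y => \tr (A y)) x = \tr (mxpd i A x).
Proof.
move=> dA; rewrite /mxtrace pd_sum => [|c]; last exact: dA.
by apply: eq_bigr => c _; rewrite mxE.
Qed.

(** * Christoffel symbols of the Grassmannian *)

Section GraphChristoffel.
Variables (R : realType) (n m : nat).
Implicit Types (z u v : 'rV[R]_(n * m)) (a b c : 'I_(n * m)).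

Let Zf z : 'M[R]_(n, m) := vec_mx z.
Let Vb a : 'M[R]_(n, m) := vec_mx (delta_mx ord0 a).
Let sf z := invmx (1%:M + Zf z *m (Zf z)^T).
Let tf z := invmx (1%:M + (Zf z)^T *m Zf z).

Let dZ z : mxdiff Zf z.
Proof. exact: (@mxC_mxdiff _ _ setT _ _ 0 Zf z (mxC_vec_mx 1 openT) I). Qed.

Let CZ : mxC 1 setT Zf. Proof. exact: mxC_vec_mx openT. Qed.

Let ds z : mxdiff sf z.
Proof.
apply: (@mxC_mxdiff _ _ setT _ _ 0 sf z _ I); apply: (mxC_inv openT).
  by move=> y _; apply: graph_gram_unitmx.
apply: (mxCD openT); first by apply: mxC_cst; exact: openT.
exact: (mxCM openT CZ (mxC_tr openT CZ)).
Qed.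

Let dt z : mxdiff tf z.
Proof.
apply: (@mxC_mxdiff _ _ setT _ _ 0 tf z _ I); apply: (mxC_inv openT).
  by move=> y _; apply: graph_cogram_unitmx.
apply: (mxCD openT); first by apply: mxC_cst; exact: openT.
exact: (mxCM openT (mxC_tr openT CZ) CZ).
Qed.

Let pds a z : mxpd a sf z = - (sf z *m (Vb a *m (Zf z)^T + Zf z *m (Vb a)^T) *m sf z).
Proof.
have dZZ := mxdiffM (dZ z) (mxdiff_tr (dZ z)).
rewrite mxpd_inv; [|by apply: (near_open openT I) => y _; apply: graph_gram_unitmx| |exact: ds].
  rewrite (mxpdD _ (mxdiff_cst _ _) dZZ) mxpd_cst add0r.
  by rewrite mxpdM ?mxpd_tr ?mxpd_vec_mx //; apply: mxdiff_tr.
by apply: mxdiffD => //; apply: mxdiff_cst.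
Qed.

Let pdt a z : mxpd a tf z = - (tf z *m ((Vb a)^T *m Zf z + (Zf z)^T *m Vb a) *m tf z).
Proof.
have dZZ := mxdiffM (mxdiff_tr (dZ z)) (dZ z).
rewrite mxpd_inv; [|by apply: (near_open openT I) => y _; apply: graph_cogram_unitmx| |exact: dt].
  rewrite (mxpdD _ (mxdiff_cst _ _) dZZ) mxpd_cst add0r.
  by rewrite mxpdM ?mxpd_tr ?mxpd_vec_mx //; apply: mxdiff_tr.
by apply: mxdiffD => //; apply: mxdiff_cst.
Qed.

Let sfT z : (sf z)^T = sf z.
Proof. by rewrite /sf trmx_inv linearD /= trmx1 trmx_mul trmxK. Qed.

Let tfT z : (tf z)^T = tf z.
Proof. by rewrite /tf trmx_inv linearD /= trmx1 trmx_mul trmxK. Qed.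

Let sZ z : sf z *m Zf z = Zf z *m tf z.
Proof.
have uS := graph_gram_unitmx (Zf z); have uT := graph_cogram_unitmx (Zf z).
rewrite -[LHS](mulmxK uT) -[X in _ = X *m _](mulKmx uS); congr (_ *m _).
rewrite -mulmxA; congr (_ *m _).
by rewrite mulmxDr mulmxDl mulmx1 mul1mx mulmxA.
Qed.

Let vec_sum u : vec_mx u = \sum_b u ord0 b *: Vb b.
Proof.
rewrite [in LHS](row_sum_delta u) linear_sum; apply: eq_bigr => b _.
by rewrite linearZ.
Qed.

Variables (E : 'M[R]_(n, m + n)) (F : 'M[R]_(m, m + n)).
Hypotheses (EE : E *m E^T = 1%:M) (EF : E *m F^T = 0) (FF : F *m F^T = 1%:M).
Let g := @grassmannian_metric R n m (graph_chart E F).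

Let gE z a b : g z a b = \tr (sf z *m Vb a *m tf z *m (Vb b)^T).
Proof. exact: grassmannian_metricE. Qed.

Let mul_g_trace z u l :
  (u *m g z) ord0 l = \tr (sf z *m vec_mx u *m tf z *m (Vb l)^T).
Proof.
rewrite mxE vec_sum mulmx_sumr !mulmx_suml raddf_sum; apply: eq_bigr => b _.
by rewrite gE /= -scalemxAr -!scalemxAl mxtraceZ.
Qed.

(** On matrices the metric acts as [V |-> s V t] with [s] and [t] invertible, which shows that it is
    nondegenerate. *)
Let mul_g z u : u *m g z = mxvec (sf z *m vec_mx u *m tf z).
Proof.
apply/rowP => l; apply: etrans (mul_g_trace _ _ _) _.
case/mxvec_indexP: l => i a; rewrite mxvecE /Vb vec_mx_delta trmx_delta.
rewrite -(mul_delta_mx (0 : 'I_1)) mulmxA mxtrace_mulC mulmxA delta_mxM linearZ /=.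
by rewrite trace_mx11 [delta_mx _ _ _ _]mxE mulr1.
Qed.

Let g_unit z : g z \in unitmx.
Proof.
rewrite -row_free_unit -kermx_eq0; apply/rowV0P => u /sub_kermxP.
rewrite mul_g => /eqP; rewrite mxvec_eq0 => /eqP e.
apply/eqP; rewrite -vec_mx_eq0; apply/eqP.
have us : sf z \in unitmx by rewrite unitmx_inv graph_gram_unitmx.
have ut : tf z \in unitmx by rewrite unitmx_inv graph_cogram_unitmx.
by rewrite -[LHS](mulKmx us) -[X in _ *m X](mulmxK ut) e mul0mx mulmx0.
Qed.

Let g_tr z : (g z)^T = g z.
Proof. by apply/matrixP => a b; rewrite !mxE dotC. Qed.

Let pd_g z a b c : pd a (fun y => g y b c) z =
  - \tr (sf z *m (Vb a *m (Zf z)^T + Zf z *m (Vb a)^T) *m sf z *m Vb b *m tf z *m (Vb c)^T)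
  - \tr (sf z *m Vb b *m tf z *m ((Vb a)^T *m Zf z + (Zf z)^T *m Vb a) *m tf z *m (Vb c)^T).
Proof.
transitivity (pd a (fun y => \tr (sf y *m Vb b *m tf y *m (Vb c)^T)) z).
  by apply: (congr1 (fun f => pd a f z)); apply/funext => y; rewrite gE.
have d1 := mxdiffM (ds z) (mxdiff_cst (Vb b) z).
have d2 := mxdiffM d1 (dt z).
rewrite pd_mxtrace; last exact: mxdiffM d2 (mxdiff_cst _ _).
rewrite (mxpdM _ d2 (mxdiff_cst _ _)) (mxpdM _ d1 (dt z)) (mxpdM _ (ds z) (mxdiff_cst _ _)).
rewrite !mxpd_cst !mulmx0 !addr0 pds pdt !(mulNmx, mulmxN) mulmxDl !mulNmx linearD /=.
by rewrite !raddfN /= !mulmxA.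
Qed.

(** The inverse metric is never computed: [koszul_trace] exhibits the lowered symbol as [G *m g],
    and multiplying by the inverse of [g] returns [G]. *)
Lemma grassmannian_christoffel z a b c :
  christoffel g z a b c =
  mxvec (- (Vb b *m (Zf z)^T *m sf z *m Vb c + Vb c *m (Zf z)^T *m sf z *m Vb b)) ord0 a.
Proof.
set G := mxvec _.
have L l : pd b (fun y => g y c l) z + pd c (fun y => g y b l) z - pd l (fun y => g y b c) z =
    2 * (G *m g z) ord0 l.
  rewrite !pd_g; have := koszul_trace (Vb b) (Vb c) (Vb l) (sfT z) (tfT z) (sZ z).
  rewrite /= => ->; by rewrite mul_g_trace mxvecK mulmxN !mulNmx raddfN mulrN.
rewrite /christoffel; under eq_bigr => l _ do rewrite L mulrCA.
rewrite -mulr_sumr mulrA mulVf ?pnatr_eq0 // mul1r.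
rewrite -[in RHS](mulmxK (g_unit z) G) [RHS]mxE; apply: eq_bigr => l _.
by rewrite mulrC; congr (_ * _); rewrite -[in RHS](g_tr z) -trmx_inv [RHS]mxE.
Qed.

Theorem grassmannian_christoffel_sum (Z U V : 'M[R]_(n, m)) a :
  let s := invmx (1%:M + Z *m Z^T) in
  \sum_b \sum_c christoffel (@grassmannian_metric R n m (graph_chart E F)) (mxvec Z) a b c
    * mxvec U ord0 b * mxvec V ord0 c =
  mxvec (- (U *m Z^T *m s *m V + V *m Z^T *m s *m U)) ord0 a.
Proof.
set u := mxvec U; set v := mxvec V; set z := mxvec Z => s.
rewrite -[Z]mxvecK -[U]mxvecK -[V]mxvecK -/z -/u -/v {}/s -[Z]mxvecK -/z.
rewrite -/g -/(Zf z) -/(sf z).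
case/mxvec_indexP: a => i a; rewrite mxvecE.
pose q (U V : 'M[R]_(n, m)) := (- (U *m (Zf z)^T *m sf z *m V + V *m (Zf z)^T *m sf z *m U)) i a.
have qC U' V' : q U' V' = q V' U' by rewrite /q addrC.
have qL t W : q (vec_mx t) W = \sum_b t ord0 b * q (Vb b) W.
  rewrite /q (vec_sum t) mulmx_sumr !mulmx_suml -big_split /= -sumrN summxE.
  apply: eq_bigr => b _.
  by rewrite -!scalemxAl -scalemxAr -scalerDr -scalerN mxE.
rewrite -[RHS]/(q (vec_mx u) (vec_mx v)) qL; apply: eq_bigr => b _.
rewrite qC qL mulr_sumr; apply: eq_bigr => c _.
by rewrite grassmannian_christoffel mxvecE -/(q _ _) qC; ring.
Qed.

End GraphChristoffel.

(** * Tension of the Gauss map *)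

(* I is the inverse metric, K the second fundamental form, C the Christoffel
   symbols, D the third derivatives of the immersion and v the gradient of the
   logarithm of the weight; the hypothesis is the differentiated self-shrinker
   equation. *)
Lemma tension_algebra (R : numFieldType) (n m : nat) (I : 'M[R]_n) (v : 'rV[R]_n)
    (K : 'I_n -> 'M[R]_(n, m)) (C : 'I_n -> 'M[R]_n) (D : 'I_n -> 'I_n -> 'M[R]_(n, m)) :
  I^T = I -> (forall i j c, K j i c = K i j c) -> (forall i j l, C j i l = C i j l) ->
  (forall i j a c, D i j a c = D a j i c) ->
  (forall a c, \sum_i \sum_j (- (I *m C a + (C a)^T *m I) i j * K j i c
     + I i j * D a j i c - I i j * (C j *m K a) i c) + (v *m I *m K a) ord0 c = 0) ->
  forall a c, \sum_i \sum_j I i j * (v ord0 i * K j a c + D i j a c - (C j *m K i) a c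
     - (C i *m K j) a c - \sum_k C i j k * K k a c) = 0.
Proof.
move=> IT Ks Cs Ds hyp a c; rewrite -[RHS](hyp a c); clear hyp.
have Is i j : I j i = I i j by rewrite -[in LHS]IT mxE.
(* The common value of four sums: the two mixed terms of the tension ([T1], [T2]) and the two halves
   of the derivative of the inverse metric ([T] itself and [T3]). *)
pose T := \sum_i \sum_j (I *m C a) i j * K j i c.
have T1 : \sum_i \sum_j I i j * (C j *m K i) a c = T.
  rewrite /T; apply: eq_bigr => i _.
  under [RHS]eq_bigr => l _ do rewrite mxE mulr_suml.
  rewrite exchange_big /=; apply: eq_bigr => j _.
  rewrite mxE mulr_sumr; apply: eq_bigr => l _.
  by rewrite mulrA (Cs a j) (Ks l i).
have T2 : \sum_i \sum_j I i j * (C i *m K j) a c = T.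
  rewrite -T1 exchange_big; apply: eq_bigr => i _; apply: eq_bigr => j _.
  by rewrite Is.
have T3 : \sum_i \sum_j ((C a)^T *m I) i j * K j i c = T.
  rewrite /T exchange_big; apply: eq_bigr => i _; apply: eq_bigr => j _.
  rewrite (Ks i j) -[(C a)^T *m I]trmxK mxE trmx_mul trmxK IT.
  by [].
have T4 : \sum_i \sum_j I i j * (v ord0 i * K j a c) = (v *m I *m K a) ord0 c.
  rewrite mxE exchange_big; apply: eq_bigr => j _.
  rewrite mxE mulr_suml; apply: eq_bigr => i _.
  by rewrite (Ks a j) mulrCA mulrA.
have T5 : \sum_i \sum_j I i j * (\sum_k C i j k * K k a c) =
    \sum_i \sum_j I i j * (C j *m K a) i c.
  rewrite exchange_big; apply: eq_bigr => i _; apply: eq_bigr => j _.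
  rewrite Is mxE; congr (_ * _); apply: eq_bigr => k _.
  by rewrite (Ks a k).
transitivity ((v *m I *m K a) ord0 c + \sum_i \sum_j I i j * D a j i c - T - T
    - \sum_i \sum_j I i j * (C j *m K a) i c).
  rewrite -T4 -{1}T1 -T2 -T5 -big_split -!sumrB; apply: eq_bigr => i _.
  rewrite -big_split -!sumrB; apply: eq_bigr => j _.
  by rewrite (Ds i j a c) /=; ring.
rewrite -{2}T3 /T.
have -> : \sum_i \sum_j (- (I *m C a + (C a)^T *m I) i j * K j i c + I i j * D a j i c -
      I i j * (C j *m K a) i c) =
    - (\sum_i \sum_j (I *m C a) i j * K j i c) - \sum_i \sum_j ((C a)^T *m I) i j * K j i c
    + \sum_i \sum_j I i j * D a j i c - \sum_i \sum_j I i j * (C j *m K a) i c.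
  rewrite -!sumrN -!big_split; apply: eq_bigr => i _ /=.
  rewrite -!sumrN -!big_split; apply: eq_bigr => j _ /=.
  by rewrite [X in - X * _]mxE; ring.
ring.
Qed.

Lemma pd_expR (R : realType) (n : nat) (f : 'rV[R]_n -> R) i x : differentiable f x ->
  differentiable (fun y => expR (f y)) x /\
  pd i (fun y => expR (f y)) x = expR (f x) * pd i f x.
Proof.
move=> df; have de : differentiable (@expR R) (f x) by apply/derivable1_diffP/derivable_expR.
have dc : differentiable (@expR R \o f) x by apply: differentiable_comp.
split; first exact: dc.
rewrite /partial (deriveE _ dc) (diff_comp df de) /= (deriveE _ df) diff1E // derive1E.
have e : 'D_1 (@expR R) (f x) = expR (f x) by apply: derive_val.
by apply: etrans (mulrC _ _) _; congr (_ * _); exact: e.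
Qed.

Lemma gram_dot (R : realType) (n k : nat) (J : 'M[R]_(n, k)) :
  \matrix_(i, j) dot (row i J) (row j J) = J *m J^T.
Proof.
apply/matrixP => i j; rewrite !mxE; apply: eq_bigr => c _.
by rewrite !mxE.
Qed.

(** * Derivatives of the immersion and the induced connection *)

Section InducedChristoffel.
Variables (R : realType) (n k : nat) (W : set 'rV[R]_n).
Variable Y : 'rV[R]_n -> 'rV[R]_k.
Hypotheses (Wo : open W) (sY : smooth W Y).
Local Notation J := (fun y => 'J Y y).
Implicit Types (x : 'rV[R]_n) (i j l a : 'I_n).

Lemma mxC_jacobian d : mxC d W J.
Proof. exact: smooth_jacobian. Qed.

Lemma mxC_smooth d : mxC d W Y.
Proof. by move=> b c; rewrite (ord1 b); apply: ((smooth_scalarC Y Wo).1 sY). Qed.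

Lemma mxpd_smooth i x : W x -> mxpd i Y x = row i ('J Y x).
Proof.
move=> Wx; rewrite jacobian_mxpd //; apply/mxdiff_row.
exact: mxC_mxdiff (mxC_smooth 1) Wx.
Qed.

Lemma mxpd_jacobian_sym i j x c : W x -> mxpd j J x i c = mxpd i J x j c.
Proof.
move=> Wx; have near_J l : \near x, 'J Y x l c = pd l (fun y => Y y ord0 c) x.
  apply: (near_open Wo Wx) => y Wy.
  by rewrite jacobian_coord //; apply/mxdiff_row; apply: mxC_mxdiff (mxC_smooth 1) Wy.
have CY : scalarC 2 W (fun y => Y y ord0 c) by apply: ((smooth_scalarC Y Wo).1 sY).
rewrite [LHS]mxE [RHS]mxE; apply: etrans (pd_near j (near_J i)) _.
apply: etrans _ (esym (pd_near i (near_J j))).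
exact: (scalarC_pd_sym j i Wo CY Wx).
Qed.

(** Exchanging the two outer derivatives first brings [i] and [a] together, where the symmetry of
    second derivatives of [Y] applies. *)
Lemma mxpd2_jacobian_sym i j a x c : W x ->
  mxpd i (mxpd j J) x a c = mxpd a (mxpd j J) x i c.
Proof.
move=> Wx; have e b d : mxpd b (mxpd d J) x = mxpd d (mxpd b J) x.
  exact: (mxpd_sym Wo _ _ (mxC_jacobian 2) Wx).
rewrite (e i j) (e a j).
rewrite [LHS]mxE [RHS]mxE; apply: pd_near.
by apply: (near_open Wo Wx) => y Wy; apply: mxpd_jacobian_sym.
Qed.

Lemma partial2_jacobian i j x : W x -> partial i (partial j Y) x = row j (mxpd i J x).
Proof.
move=> Wx; have dY y : W y -> differentiable Y y.
  by move=> Wy; apply/mxdiff_row; apply: mxC_mxdiff (mxC_smooth 1) Wy.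
have drow : differentiable (fun y => row j ('J Y y)) x.
  apply/differentiable_rowP => c; rewrite (_ : (fun y => _) = (fun y => 'J Y y j c)).
    exact: (mxC_mxdiff (mxC_jacobian 1) Wx).
  by apply/funext => y; rewrite mxE.
transitivity (partial i (fun y => row j ('J Y y)) x).
  apply: near_eq_derive; apply: (near_open Wo Wx) => y /dY dYy.
  by rewrite jacobian_row.
apply/rowP => c; rewrite (partial_coord _ _ drow) !mxE.
by apply: (congr1 (fun f => pd i f x)); apply/funext => y; rewrite mxE.
Qed.

Lemma induced_christoffel x a i j : W x ->
  christoffel (fun y => \matrix_(i, j) dot (row i ('J Y y)) (row j ('J Y y))) x a i j =
  (mxpd i J x *m ('J Y x)^T *m invmx ('J Y x *m ('J Y x)^T)) j a.
Proof.
move=> Wx; have dJ : mxdiff J x := mxC_mxdiff (mxC_jacobian 1) Wx.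
have [N NE] : exists N, forall l, N l = mxpd l J x *m ('J Y x)^T.
  by exists (fun l => mxpd l J x *m ('J Y x)^T).
have Ns i' j' l : N i' j' l = N j' i' l.
  by rewrite !NE [LHS]mxE [RHS]mxE; apply: eq_bigr => c _; congr (_ * _); exact: mxpd_jacobian_sym.
have pdG i' j' l : pd i' (fun y => (\matrix_(i, j) dot (row i ('J Y y)) (row j ('J Y y))) j' l) x
    = N i' j' l + N i' l j'.
  transitivity (mxpd i' (fun y => 'J Y y *m ('J Y y)^T) x j' l).
    by rewrite mxE; apply: (congr1 (fun f => pd i' f x)); apply/funext => y; rewrite gram_dot.
  rewrite (mxpdM _ dJ (mxdiff_tr dJ)) mxpd_tr mxE NE; congr (_ + _).
  have NT : (N i')^T = 'J Y x *m (mxpd i' J x)^T by rewrite NE trmx_mul trmxK.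
  by rewrite -NT [LHS]mxE NE.
rewrite /christoffel; under eq_bigr => l _ do rewrite !pdG.
rewrite gram_dot mulr_sumr -NE [RHS]mxE; apply: eq_bigr => l _.
(* [N i j l] is the product of [d_i d_j Y] with [d_l Y], symmetric in [i] and [j], so four of the
   six terms cancel. *)
have -> : N i j l + N i l j + (N j i l + N j l i) - (N l i j + N l j i) = 2 * N i j l.
  by rewrite (Ns l i) (Ns l j) (Ns j i); ring.
rewrite mulrCA mulKf ?pnatr_eq0 // mulrC; congr (_ * _).
set G := 'J Y x *m _; have GT : G^T = G by rewrite /G trmx_mul trmxK.
by rewrite -[in LHS]GT -trmx_inv mxE.
Qed.

End InducedChristoffel.

(** Splits [E^T S] along the graph basis [E + Z F] and along the columns of [F^T - E^T Z], which are
    orthogonal to that basis for orthonormal frames. *)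
Lemma graph_tr_decomp (R : comNzRingType) (n m k : nat) (E : 'M[R]_(n, k)) (F : 'M[R]_(m, k))
    (Z : 'M[R]_(n, m)) :
  E^T *m (1%:M + Z *m Z^T) = (E + Z *m F)^T - (F^T - E^T *m Z) *m Z^T.
Proof.
rewrite mulmxDr mulmx1 mulmxBl [(E + _)^T]linearD /= trmx_mul opprB addrACA.
by rewrite subrr addr0 mulmxA.
Qed.

(** * The Gauss map and its tension in a graph chart *)

Section GaussTension.
Variables (R : realType) (n m : nat) (E : 'M[R]_(n, m + n)) (F : 'M[R]_(m, m + n)).
Hypotheses (EE : E *m E^T = 1%:M) (EF : E *m F^T = 0) (FF : F *m F^T = 1%:M).
Variables (W : set 'rV[R]_n) (Y : 'rV[R]_n -> 'rV[R]_(m + n)).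
Hypotheses (Wo : open W) (sY : smooth W Y).
Hypothesis J_free : forall x, W x -> row_free ('J Y x).
Hypothesis JE_gt0 : forall x, W x -> 0 < \det ('J Y x *m E^T).

Local Notation J := (fun y => 'J Y y).
Let Z y := invmx ('J Y y *m E^T) *m ('J Y y *m F^T).
Let P y := F^T - E^T *m Z y.
(* The columns of P y are normal at Y y, K j y is the second fundamental form
   B(d_j, _) paired with them and the entry (i, k) of C j y is the Christoffel
   symbol Gamma^k_ij of the induced metric. *)
Let K j y := mxpd j J y *m P y.
Let I y := invmx ('J Y y *m ('J Y y)^T).
Let C j y := mxpd j J y *m ('J Y y)^T *m I y.
Let s y := invmx (1%:M + Z y *m (Z y)^T).

Implicit Types (x : 'rV[R]_n) (i j a : 'I_n).

Let uQ x : W x -> 'J Y x *m E^T \in unitmx.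
Proof. by move=> Wx; rewrite unitmxE unitfE gt_eqF // JE_gt0. Qed.

Let uG x : W x -> 'J Y x *m ('J Y x)^T \in unitmx.
Proof. by move=> /J_free; apply: gram_unitmx. Qed.

Let CJ d : mxC d W J.
Proof. exact: mxC_jacobian. Qed.

Let CE d p (A : 'M[R]_(p, m + n)) : mxC d W (fun y => 'J Y y *m A^T).
Proof. by apply: (mxCM Wo); [exact: CJ|exact: mxC_cst]. Qed.

Let CZ d : mxC d W Z.
Proof. by apply: (mxCM Wo); [apply: (mxC_inv Wo uQ); exact: CE|exact: CE]. Qed.

Let CI d : mxC d W I.
Proof. by apply: (mxC_inv Wo uG); apply: (mxCM Wo); [exact: CJ|apply: (mxC_tr Wo); exact: CJ]. Qed.

Let dJ x : W x -> mxdiff J x.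
Proof. exact: mxC_mxdiff (CJ 1). Qed.

Let dZ x : W x -> mxdiff Z x.
Proof. exact: mxC_mxdiff (CZ 1). Qed.

Let dI x : W x -> mxdiff I x.
Proof. exact: mxC_mxdiff (CI 1). Qed.

Let dJ' j x : W x -> mxdiff (mxpd j J) x.
Proof. exact: mxC_mxdiff (mxC_pd Wo j (CJ 2)). Qed.

Let dZ' j x : W x -> mxdiff (mxpd j Z) x.
Proof. exact: mxC_mxdiff (mxC_pd Wo j (CZ 2)). Qed.


Let dP x : W x -> mxdiff P x.
Proof.
move=> Wx; apply: mxdiffD; first exact: mxdiff_cst.
apply: mxdiffN; exact: mxdiffM (mxdiff_cst _ _) (dZ Wx).
Qed.

Let pdP i x : W x -> mxpd i P x = - (E^T *m mxpd i Z x).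
Proof.
move=> Wx; have d1 := mxdiffM (mxdiff_cst E^T x) (dZ Wx).
rewrite (mxpdD _ (mxdiff_cst _ _) (mxdiffN d1)) mxpd_cst add0r (mxpdN _ d1).
by rewrite (mxpdM _ (mxdiff_cst _ _) (dZ Wx)) mxpd_cst mul0mx add0r.
Qed.

Let JP x : W x -> 'J Y x *m P x = 0.
Proof. by move=> Wx; rewrite mulmxBr mulmxA /Z mulKVmx ?subrr // uQ. Qed.

Let dK j x : W x -> mxdiff (K j) x.
Proof. by move=> Wx; exact: mxdiffM (dJ' j Wx) (dP Wx). Qed.

Let pdK i j x : W x ->
  mxpd i (K j) x = mxpd i (mxpd j J) x *m P x - mxpd j J x *m E^T *m mxpd i Z x.
Proof.
move=> Wx; rewrite (mxpdM _ (dJ' j Wx) (dP Wx)) (pdP i Wx).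
by rewrite mulmxN mulmxA.
Qed.

Let pdJE j p (A : 'M[R]_(p, m + n)) x : W x ->
  mxpd j (fun y => 'J Y y *m A^T) x = mxpd j J x *m A^T.
Proof.
by move=> Wx; rewrite (mxpdM _ (dJ Wx) (mxdiff_cst _ _)) mxpd_cst mulmx0 addr0.
Qed.

Let dJE p (A : 'M[R]_(p, m + n)) x : W x -> mxdiff (fun y => 'J Y y *m A^T) x.
Proof. by move=> Wx; exact: mxdiffM (dJ Wx) (mxdiff_cst _ _). Qed.

(** Obtained by differentiating [Q Z = J F^T] with [Q = J E^T]: the leftover [dJ (F^T - E^T Z)] is
    [dJ P]. *)
Let QZ' j x : W x -> 'J Y x *m E^T *m mxpd j Z x = K j x.
Proof.
move=> Wx; have QZ : mxpd j (fun y => 'J Y y *m E^T *m Z y) x = mxpd j J x *m F^T.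
  rewrite -(pdJE j F Wx); apply: mxpd_near; apply: (near_open Wo Wx) => y Wy.
  by rewrite /Z mulKVmx // uQ.
move: QZ; rewrite (mxpdM _ (dJE E Wx) (dZ Wx)) (pdJE j E Wx) => QZ.
by rewrite /K /P mulmxBr -QZ (mulmxA (mxpd j J x) E^T (Z x)) addrC addKr.
Qed.

Let QZ'' i j x : W x -> 'J Y x *m E^T *m mxpd i (mxpd j Z) x =
  mxpd i (mxpd j J) x *m P x - mxpd j J x *m E^T *m mxpd i Z x
  - mxpd i J x *m E^T *m mxpd j Z x.
Proof.
move=> Wx; have QZ : mxpd i (fun y => 'J Y y *m E^T *m mxpd j Z y) x = mxpd i (K j) x.
  by apply: mxpd_near; apply: (near_open Wo Wx) => y Wy; apply: QZ'.
move: QZ; rewrite (mxpdM _ (dJE E Wx) (dZ' j Wx)) (pdJE i E Wx) (pdK i j Wx) => <-.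
by rewrite addrC addKr.
Qed.

(* Tangential and normal parts of the columns of E^T. *)
Let E_decomp x : W x -> E^T = ('J Y x)^T *m I x *m ('J Y x *m E^T) - P x *m (Z x)^T *m s x.
Proof.
move=> Wx; set Q := 'J Y x *m E^T; have uQx : Q \in unitmx := uQ Wx.
have uS := graph_gram_unitmx (Z x).
pose B := E + Z x *m F; have JB : 'J Y x = Q *m B := graph_decomp EE EF FF uQx.
have BB : B *m B^T = 1%:M + Z x *m (Z x)^T := graph_gram EE EF FF _ _.
(* Since [J = Q B], the Gram matrix of [J] is [Q S Q^T], whose inverse times [Q] is [Q^-T S^-1]. *)
have IQ : I x *m Q = invmx Q^T *m s x.
  rewrite -[RHS](mulKmx (uG Wx)) -/(I x); congr (_ *m _).
  have -> : 'J Y x *m ('J Y x)^T = Q *m (1%:M + Z x *m (Z x)^T) *m Q^T.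
    by rewrite JB trmx_mul -BB !mulmxA.
  rewrite -(mulmxA _ Q^T) (mulmxA Q^T) mulmxV ?unitmx_tr // mul1mx.
  by rewrite -mulmxA mulmxV // mulmx1.
have -> : ('J Y x)^T *m I x *m Q = B^T *m s x.
  by rewrite -mulmxA IQ JB trmx_mul -mulmxA mulKVmx // unitmx_tr.
rewrite -mulmxBl -[LHS](mulmxK uS) -/(s x); congr (_ *m _).
exact: graph_tr_decomp.
Qed.

(** [E_decomp] is inserted between [dJ] and [dZ]. The tangential part gives the induced Christoffel
    symbols, the normal part the quadratic term to be matched with the Grassmannian. *)
Let JEZ i j x : W x ->
  mxpd j J x *m E^T *m mxpd i Z x = C j x *m K i x - K j x *m ((Z x)^T *m s x *m mxpd i Z x).
Proof.
move=> Wx; rewrite [in LHS](E_decomp Wx) mulmxBr mulmxBl; congr (_ - _).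
  by rewrite -(QZ' i Wx) /C -!mulmxA.
by rewrite /K -!mulmxA.
Qed.

Hypothesis shrinker : forall x, W x ->
  \sum_i \sum_j invmx (\matrix_(i, j) dot (row i ('J Y x)) (row j ('J Y x))) i j *:
    normal_part ('J Y x) (partial i (partial j Y) x) =
  - 2^-1 *: normal_part ('J Y x) (Y x).

Let normal_partP x v : W x -> normal_part ('J Y x) v *m P x = v *m P x.
Proof.
by move=> Wx; rewrite /normal_part mulmxBl -(mulmxA _ ('J Y x)) JP // mulmx0 subr0.
Qed.

Let K_sym i j x c : W x -> K j x i c = K i x j c.
Proof.
move=> Wx; rewrite [LHS]mxE [RHS]mxE; apply: eq_bigr => l _; congr (_ * _).
exact: (mxpd_jacobian_sym Wo sY).
Qed.

Let shrinkerP x c : W x ->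
  \sum_i \sum_j I x i j * K j x i c + 2^-1 * (Y x *m P x) ord0 c = 0.
Proof.
move=> Wx; have /(congr1 (fun v => (v *m P x) ord0 c)) := shrinker Wx.
rewrite gram_dot -scalemxAl (normal_partP _ Wx) [RHS]mxE mulNr => /eqP.
rewrite -addr_eq0 => /eqP e; rewrite -[RHS]e {e}; congr (_ + _).
rewrite mulmx_suml summxE; apply: eq_bigr => i _.
rewrite mulmx_suml summxE; apply: eq_bigr => j _.
rewrite -scalemxAl (normal_partP _ Wx) [RHS]mxE; congr (_ * _).
apply: etrans (K_sym _ _ _ Wx) _.
by rewrite (partial2_jacobian Wo sY i j Wx) -row_mul [RHS]mxE.
Qed.

Let shrinker_pd a x c : W x ->
  \sum_i \sum_j (mxpd a I x i j * K j x i c + I x i j * mxpd a (K j) x i c)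
  + 2^-1 * mxpd a (fun y => Y y *m P y) x ord0 c = 0.
Proof.
move=> Wx.
have dY : mxdiff Y x := mxC_mxdiff (mxC_smooth Wo sY 1) Wx.
have dYP := mxdiffM dY (dP Wx).
have dIK i j : differentiable (fun y => I y i j * K j y i c) x.
  exact: differentiableM (dI Wx i j) (dK j Wx i c).
have dIKs i : differentiable (fun y => \sum_j I y i j * K j y i c) x.
  by apply: differentiable_bigsum => j.
have dIKss : differentiable (fun y => \sum_i \sum_j I y i j * K j y i c) x.
  by apply: differentiable_bigsum => i.
have d2 : differentiable (fun y => 2^-1 * (Y y *m P y) ord0 c) x.
  by apply: differentiableM; [exact: differentiable_cst|exact: dYP].
have := pdD a dIKss d2; rewrite (pd_near a (g := fun=> 0)); last first.
  by apply: (near_open Wo Wx) => y Wy; apply: shrinkerP.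
rewrite pd_cst => e; rewrite [RHS]e {e}; congr (_ + _).
  rewrite (pd_sum a _ _ dIKs); apply: eq_bigr => i _.
  rewrite (pd_sum a _ _ (dIK i)); apply: eq_bigr => j _.
  by rewrite (pdM a (dI Wx i j) (dK j Wx i c)); congr (_ * _ + _ * _); rewrite mxE.
rewrite (pdM a (differentiable_cst _ _) (dYP ord0 c)) pd_cst mul0r add0r.
by congr (_ * _); rewrite mxE.
Qed.

Let IT x : (I x)^T = I x.
Proof. by rewrite /I trmx_inv trmx_mul trmxK. Qed.

Let pdI a x : W x -> mxpd a I x = - (I x *m C a x + (C a x)^T *m I x).
Proof.
move=> Wx; have dG := mxdiffM (dJ Wx) (mxdiff_tr (dJ Wx)).
rewrite mxpd_inv; [|by apply: (near_open Wo Wx) => y; apply: uG|exact: dG|exact: dI].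
rewrite (mxpdM _ (dJ Wx) (mxdiff_tr (dJ Wx))) mxpd_tr -/(I x); congr (- _).
by rewrite mulmxDr mulmxDl /C !trmx_mul trmxK IT !mulmxA.
Qed.

(** The gradient of the logarithm of the weight: the factor 1/4 in the exponent meets the 2 from
    differentiating a square. *)
Let v x := - 2^-1 *: (Y x *m ('J Y x)^T).
Let D i j x := mxpd i (mxpd j J) x *m P x.

(** The derivative of [Y] is tangent and is killed by [P], so only [dP = - E^T dZ] contributes;
    [E_decomp] then separates its two parts. *)
Let pdYP a x : W x -> mxpd a (fun y => Y y *m P y) x =
  - (Y x *m ('J Y x)^T *m I x *m K a x) + Y x *m P x *m ((Z x)^T *m s x *m mxpd a Z x).
Proof.
move=> Wx; have dY : mxdiff Y x := mxC_mxdiff (mxC_smooth Wo sY 1) Wx.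
rewrite (mxpdM _ dY (dP Wx)) (mxpd_smooth Wo sY _ Wx) -row_mul (JP Wx) (pdP _ Wx) linear0 add0r.
rewrite mulmxN -[RHS]opprK; congr (- _); rewrite opprD opprK.
rewrite {1}(E_decomp Wx) mulmxBl mulmxBr; congr (_ - _).
  by rewrite -(QZ' a Wx) -!mulmxA.
by rewrite -!mulmxA.
Qed.

Let shrinker_tension a c x : W x ->
  \sum_i \sum_j (- (I x *m C a x + (C a x)^T *m I x) i j * K j x i c
    + I x i j * D a j x i c - I x i j * (C j x *m K a x) i c) + (v x *m I x *m K a x) ord0 c = 0.
Proof.
move=> Wx; set M := (Z x)^T *m s x *m mxpd a Z x.
rewrite -[RHS](shrinker_pd a c Wx) (pdYP _ Wx) -/M.
(* The normal parts coming from [dK] and from [d (Y P)] share the right factor [M]; together they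
   are [shrinkerP] multiplied by [M]. *)
have KM : \sum_i \sum_j I x i j * (K j x *m M) i c + 2^-1 * (Y x *m P x *m M) ord0 c = 0.
  transitivity (\sum_d (\sum_i \sum_j I x i j * K j x i d + 2^-1 * (Y x *m P x) ord0 d) * M d c).
    under [RHS]eq_bigr => d _ do rewrite mulrDl.
    rewrite big_split /=; congr (_ + _); last first.
      by rewrite mxE mulr_sumr; apply: eq_bigr => d _; rewrite mulrA.
    under [RHS]eq_bigr => d _ do rewrite mulr_suml.
    rewrite [RHS]exchange_big /=; apply: eq_bigr => i _.
    under [RHS]eq_bigr => d _ do rewrite mulr_suml.
    rewrite [RHS]exchange_big /=; apply: eq_bigr => j _.
    by rewrite mxE mulr_sumr; apply: eq_bigr => d _; rewrite mulrA.
  by rewrite big1 // => d _; rewrite shrinkerP // mul0r.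
have addE (A B : 'rV[R]_m) : (- A + B) ord0 c = - A ord0 c + B ord0 c by rewrite !mxE.
have subE (A B G : 'M[R]_(n, m)) i : (A - (B - G)) i c = A i c - B i c + G i c.
  by rewrite !mxE; ring.
rewrite -[LHS]addr0 -[X in _ + X = _]KM addE mulrDr addrACA -big_split /=; congr (_ + (_ + _)).
  apply: eq_bigr => i _; rewrite -big_split /=; apply: eq_bigr => j _.
  rewrite (pdI _ Wx) (pdK a j Wx) (JEZ a j Wx) -/M -/(D a j x) subE [in RHS]mxE; ring.
by rewrite /v -!scalemxAl [LHS]mxE mulNr mulrN.
Qed.

Let C_sym i j l x : W x -> C j x i l = C i x j l.
Proof.
move=> Wx; have CE' b : C b x = mxpd b J x *m (('J Y x)^T *m I x) by rewrite /C mulmxA.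
rewrite (CE' i) (CE' j) [LHS]mxE [RHS]mxE.
by apply: eq_bigr => c _; congr (_ * _); exact: (mxpd_jacobian_sym Wo sY).
Qed.

Let D_sym i j a c x : W x -> D i j x a c = D a j x i c.
Proof.
move=> Wx; rewrite [LHS]mxE [RHS]mxE; apply: eq_bigr => l _; congr (_ * _).
exact: (mxpd2_jacobian_sym Wo sY).
Qed.

(** The weighted tension in matrix coordinates: the trace of [d log w (x) dZ] plus the covariant
    derivative of [dZ], the weight itself having been divided out. *)
Let tension_matrix x := \sum_i \sum_j I x i j *:
  (v x ord0 i *: mxpd j Z x + mxpd i (mxpd j Z) x
   - (mxpd i Z x *m (Z x)^T *m s x *m mxpd j Z x + mxpd j Z x *m (Z x)^T *m s x *m mxpd i Z x)
   - \sum_k C i x j k *: mxpd k Z x).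

Let tension_matrix0 x : W x -> tension_matrix x = 0.
Proof.
(* Multiplication by the invertible [J E^T] replaces the derivatives of [Z] by the second
   fundamental form and its derivatives. *)
move=> Wx; suff : 'J Y x *m E^T *m tension_matrix x = 0.
  by move=> /(congr1 (mulmx (invmx ('J Y x *m E^T)))); rewrite mulKmx ?uQ // mulmx0.
have Qterm i j : 'J Y x *m E^T *m (v x ord0 i *: mxpd j Z x + mxpd i (mxpd j Z) x
   - (mxpd i Z x *m (Z x)^T *m s x *m mxpd j Z x + mxpd j Z x *m (Z x)^T *m s x *m mxpd i Z x)
   - \sum_k C i x j k *: mxpd k Z x) =
   v x ord0 i *: K j x + D i j x - C j x *m K i x - C i x *m K j x - \sum_k C i x j k *: K k x.
  have lin (q : 'M[R]_n) t (A1 A2 A3 A4 A5 : 'M[R]_(n, m)) :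
      q *m (t *: A1 + A2 - (A3 + A4) - A5) =
      t *: (q *m A1) + q *m A2 - (q *m A3 + q *m A4) - q *m A5.
    by rewrite !(mulmxBr, mulmxDr) -scalemxAr.
  have quad i' j' : 'J Y x *m E^T *m (mxpd i' Z x *m (Z x)^T *m s x *m mxpd j' Z x) =
      K i' x *m ((Z x)^T *m s x *m mxpd j' Z x).
    by rewrite -(QZ' i' Wx) !mulmxA.
  have e2 : 'J Y x *m E^T *m mxpd i (mxpd j Z) x = D i j x
      - (C j x *m K i x - K j x *m ((Z x)^T *m s x *m mxpd i Z x))
      - (C i x *m K j x - K i x *m ((Z x)^T *m s x *m mxpd j Z x)).
    by apply: etrans (QZ'' i j Wx) _; congr (_ - _ - _); exact: JEZ.
  apply: etrans (lin _ _ _ _ _ _ _) _.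
  have e5 : 'J Y x *m E^T *m (\sum_k C i x j k *: mxpd k Z x) = \sum_k C i x j k *: K k x.
    by rewrite mulmx_sumr; apply: eq_bigr => k _; rewrite -scalemxAr (QZ' k Wx).
  apply: etrans (f_equal2 (fun A B : 'M[R]_(n, m) => A - B) (f_equal2 (fun A B => A - B)
    (f_equal2 +%R (congr1 ( *:%R (v x ord0 i)) (QZ' j Wx)) e2)
    (f_equal2 +%R (quad i j) (quad j i))) e5) _.
  (* [m1] and [m2] are the normal halves produced by [JEZ]; the Christoffel term of the Grassmannian
     removes them exactly. *)
  have fin (t d k1 k2 m1 m2 S : 'M[R]_(n, m)) :
      t + (d - (k1 - m1) - (k2 - m2)) - (m2 + m1) - S = t + d - k1 - k2 - S.
    by apply/matrixP => p q; rewrite !mxE; ring.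
  exact: fin.
rewrite /tension_matrix mulmx_sumr; apply/matrixP => a c; rewrite mxE summxE.
rewrite -[RHS](@tension_algebra _ _ _ (I x) (v x) (K ^~ x) (C ^~ x) (fun i j => D i j x)
  (IT x) (fun i j c => K_sym i j c Wx) (fun i j l => C_sym i j l Wx)
  (fun i j a c => D_sym i j a c Wx) (fun a c => shrinker_tension a c Wx) a c).
apply: eq_bigr => i _; rewrite mulmx_sumr summxE; apply: eq_bigr => j _.
rewrite -scalemxAr Qterm [LHS]mxE; congr (_ * _).
have subE (A1 A2 A3 A4 A5 : 'M[R]_(n, m)) :
  (v x ord0 i *: A1 + A2 - A3 - A4 - A5) a c =
  v x ord0 i * A1 a c + A2 a c - A3 a c - A4 a c - A5 a c by rewrite !mxE.
rewrite subE summxE; congr (_ - _).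
by apply: eq_bigr => k _; rewrite mxE.
Qed.

Variable f : 'rV[R]_n -> 'rV[R]_(n * m).
Hypothesis f_chart : forall y, W y ->
  f y = mxvec (invmx ('J Y y *m E^T) *m ('J Y y *m F^T)).

Let fE y : W y -> f y = mxvec (Z y).
Proof. exact: f_chart. Qed.

Let f_coord a b y : W y ->
  \near y, f y ord0 (mxvec_index a b) = Z y a b.
Proof. by move=> Wy; apply: (near_open Wo Wy) => z Wz; rewrite (fE Wz) mxvecE. Qed.

Let df y : W y -> differentiable f y.
Proof.
move=> Wy; apply/differentiable_rowP; case/mxvec_indexP => a b.
apply: near_eq_differentiable (dZ Wy a b); have := f_coord a b Wy.
by apply: filterS => z ->.
Qed.

Let Jf j y p : W y -> 'J f y j p = mxvec (mxpd j Z y) ord0 p.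
Proof.
move=> Wy; apply: etrans (jacobian_coord _ _ (df Wy)) _.
case/mxvec_indexP: p => a b; rewrite mxvecE [RHS]mxE.
exact: pd_near (f_coord a b Wy).
Qed.

Let w y := expR (- (dot (Y y) (Y y) / 4)).

Let pdw i x : W x -> differentiable w x /\ pd i w x = w x * v x ord0 i.
Proof.
move=> Wx; have dY : mxdiff Y x := mxC_mxdiff (mxC_smooth Wo sY 1) Wx.
have ddot := differentiable_dot dY.
have d1 : differentiable (fun y => - (dot (Y y) (Y y) / 4)) x.
  apply: differentiableN; apply: differentiableM => //; exact: differentiable_cst.
have [dw ->] := pd_expR i d1; split; first exact: dw.
rewrite -/(w x); congr (_ * _).
rewrite pdN; last by apply: differentiableM => //; exact: differentiable_cst.
rewrite (pdM i ddot (differentiable_cst _ _)) pd_cst mulr0 addr0 (pd_dot dY).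
rewrite (mxpd_smooth Wo sY _ Wx) /v [RHS]mxE.
have -> : (Y x *m ('J Y x)^T) ord0 i = dot (Y x) (row i ('J Y x)).
  by rewrite mxE; apply: eq_bigr => c _; rewrite !mxE.
by rewrite (_ : cst _ x = 4^-1) //; field.
Qed.

Let h := @grassmannian_metric R n m (graph_chart E F).
Let g y := \matrix_(i, j) dot (row i ('J Y y)) (row j ('J Y y)).

(** The weight factors out because its gradient is [w v] and both Christoffel sums are linear in the
    section; these sums are given by [induced_christoffel] and [grassmannian_christoffel_sum]. *)
Let cov_derivE i j x : W x ->
  cov_deriv g h f (fun y => w y *: 'J f y) x i j = w x *: mxvec
  (v x ord0 i *: mxpd j Z x + mxpd i (mxpd j Z) x
   - (mxpd i Z x *m (Z x)^T *m s x *m mxpd j Z x + mxpd j Z x *m (Z x)^T *m s x *m mxpd i Z x)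
   - \sum_k C i x j k *: mxpd k Z x).
Proof.
move=> Wx; have [dw pdwE] := pdw i Wx.
apply/rowP => p; rewrite mxE.
have -> : pd i (fun y => (w y *: 'J f y) j p) x =
    w x * mxvec (v x ord0 i *: mxpd j Z x + mxpd i (mxpd j Z) x) ord0 p.
  case/mxvec_indexP: p => a b; rewrite mxvecE.
  transitivity (pd i (fun y => w y * mxpd j Z y a b) x).
    apply: pd_near; apply: (near_open Wo Wx) => y Wy.
    by rewrite [LHS]mxE (Jf _ _ Wy) mxvecE.
  rewrite (pdM i dw (dZ' j Wx a b)) pdwE [X in _ = _ * X]mxE [X in _ = _ * (X + _)]mxE.
  by rewrite mulrDr mulrA; congr (_ + _ * _); rewrite [RHS]mxE.
have -> : \sum_k christoffel g x k i j * (w x *: 'J f x) k p =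
    w x * mxvec (\sum_k C i x j k *: mxpd k Z x) ord0 p.
  case/mxvec_indexP: p => a b; rewrite mxvecE summxE mulr_sumr; apply: eq_bigr => k _.
  rewrite (induced_christoffel Wo sY _ _ _ Wx) [X in _ * X]mxE (Jf _ _ Wx) mxvecE.
  by rewrite mulrCA [X in _ = _ * X]mxE.
have -> : \sum_b \sum_c christoffel h (f x) p b c * 'J f x i b * (w x *: 'J f x) j c =
    w x * mxvec (- (mxpd i Z x *m (Z x)^T *m s x *m mxpd j Z x
      + mxpd j Z x *m (Z x)^T *m s x *m mxpd i Z x)) ord0 p.
  rewrite -(grassmannian_christoffel_sum EE EF FF) mulr_sumr; apply: eq_bigr => b _.
  rewrite mulr_sumr; apply: eq_bigr => c _.
  by rewrite [X in _ * X = _]mxE !(Jf _ _ Wx) (fE Wx) mulrCA.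
case/mxvec_indexP: p => a b; rewrite [RHS]mxE !mxvecE -mulrBr -mulrDr; congr (_ * _).
move: (_ + mxpd i (mxpd j Z) x) (_ + _ *m mxpd i Z x) (\sum_k _ *: _) => A1 A2 A3.
by rewrite !mxE addrAC.
Qed.

Theorem gauss_map_tension x : W x ->
  weighted_tension (fun y => \matrix_(i, j) dot (row i ('J Y y)) (row j ('J Y y)))
    (@grassmannian_metric R n m (graph_chart E F))
    (fun y => expR (- (dot (Y y) (Y y) / 4))) f x = 0.
Proof.
move=> Wx; rewrite -/g -/h -/w /weighted_tension.
have w0 : w x != 0 by rewrite gt_eqF // expR_gt0.
have -> : \sum_i \sum_j invmx (g x) i j *: cov_deriv g h f (fun y => w y *: 'J f y) x i j =
    w x *: mxvec (tension_matrix x).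
  rewrite /tension_matrix linear_sum scaler_sumr; apply: eq_bigr => i _.
  rewrite linear_sum scaler_sumr; apply: eq_bigr => j _.
  rewrite (cov_derivE i j Wx) scalerA mulrC -scalerA /g gram_dot; congr (_ *: _).
  exact/esym/linearZ.
by rewrite (tension_matrix0 Wx) linear0 !scaler0.
Qed.

End GaussTension.

(** * Charts of the submanifold *)

Lemma smooth_subset (R : realType) (n l : nat) (U W : set 'rV[R]_n) (f : 'rV[R]_n -> 'rV[R]_l) :
  W `<=` U -> smooth U f -> smooth W f.
Proof.
move=> WU sf k; have := sf k; elim: k f {sf} => [|k IHk] f; first by move=> cf x /WU; apply: cf.
by move=> [df pf]; split=> [x /WU|i]; [exact: df|exact: IHk (pf i)].
Qed.

Lemma jacobian_comp (R : realType) (n l k : nat) (f : 'rV[R]_n -> 'rV[R]_l)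
    (g : 'rV[R]_l -> 'rV[R]_k) x :
  differentiable f x -> differentiable g (f x) ->
  'J (g \o f) x = 'J f x *m 'J g (f x).
Proof.
move=> df dg; have dc : differentiable (g \o f) x by apply: differentiable_comp.
apply/row_matrixP => i; rewrite row_mul (jacobian_row i dc) (jacobian_row i df).
rewrite /partial (deriveE _ dc) (diff_comp df dg) /= -deriveEjacobian //.
by rewrite (deriveE _ dg) (deriveE _ df).
Qed.

Section GaussMapCharts.
Variables (R : realType) (m n : nat) (M : topologicalType) (A : set (chart R n M)).
Variable X : M -> 'rV[R]_(m + n).
Hypothesis hM : oriented_manifold A.

(** [dom d] is pulled back along the continuous [param c]. Openness allows the change of charts to
    be differentiated in [tangent_basis_transition]. *)
Lemma transition_dom_open c d : A c -> A d -> open (transition_dom c d).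
Proof.
move=> Ac Ad; rewrite openE => x [p [cp dp] <-{x}].
have Uo := om_image_open hM Ac; have Uc : (coord c @` dom c) (coord c p) by exists p.
have pc : {for coord c p, continuous (param c)}.
  have := om_param_cont hM Ac; rewrite continuous_open_subspace //.
  by apply; rewrite inE.
have nd : nbhs (coord c p) (param c @^-1` dom d).
  apply: pc; rewrite (om_coordK hM Ac cp).
  exact: (open_nbhs_nbhs (conj (om_dom_open hM Ad) dp)).
have nU : nbhs (coord c p) (coord c @` dom c) by apply: open_nbhs_nbhs.
apply: filterS2 nd nU => y /= dy [q cq qy]; exists q => //; split=> //.
by move: dy; rewrite -qy (om_coordK hM Ac cq).
Qed.

Hypothesis hX : immersion A X.

Lemma tangent_basis_transition c d p : A c -> A d -> dom c p -> dom d p ->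
  tangent_basis X c p = 'J (transition c d) (coord c p) *m tangent_basis X d p.
Proof.
move=> Ac Ad cp dp; have tcp : transition_dom c d (coord c p) by exists p.
have tp : transition c d (coord c p) = coord d p.
  by rewrite /transition /= (om_coordK hM Ac cp).
have dt : differentiable (transition c d) (coord c p).
  by have [dt _] := om_smooth hM Ac Ad 1%N; apply: dt.
have dX e q : A e -> dom e q -> differentiable (X \o param e) (coord e q).
  by move=> Ae eq; have [/(_ 1%N)[dXe _] _] := hX Ae; apply: dXe; exists q.
have dXt : differentiable (X \o param d) (transition c d (coord c p)).
  by rewrite tp; exact: dX.
have XE : \forall y \near coord c p,
    (X \o param c) y = ((X \o param d) \o transition c d) y.
  apply: (near_open (transition_dom_open Ac Ad) tcp) => y [q [cq dq] <-].
  by rewrite /transition /= (om_coordK hM Ac cq) (om_coordK hM Ad dq).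
apply: etrans (jacobian_near XE (dX _ _ Ac cp)) _.
apply: etrans (jacobian_comp dt dXt) _.
exact: (congr1 (fun y => 'J (transition c d) (coord c p) *m 'J (X \o param d) y) tp).
Qed.

(** The default of [gauss_map] is never reached: the oriented span of the tangent basis in one chart
    serves all charts at [p], the Jacobians of the transitions having positive determinant. *)
Lemma gauss_map_basis c p : A c -> dom c p ->
  positive_basis (gauss_map A X p) (tangent_basis X c p).
Proof.
move=> Ac cp; suff [P PP] : exists P : 'G[R]_(n, m), forall c, A c -> dom c p ->
    positive_basis P (tangent_basis X c p).
  have := @xgetPex _ (standard_plane R n m) [set P : 'G[R]_(n, m) |
    forall c, A c -> dom c p -> positive_basis P (tangent_basis X c p)].
  by apply => //; exists P.
have [_ /(_ _ cp) Xfree] := hX Ac.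
exists (oriented_span (tangent_basis X c p)) => d Ad dp.
have PB := positive_basis_span Xfree.
apply/(positive_basisP _ PB); exists ('J (transition d c) (coord d p)).
  by apply: (om_positive hM Ad Ac); exists p.
exact: tangent_basis_transition.
Qed.

Variables (E : 'M[R]_(n, m + n)) (F : 'M[R]_(m, m + n)).
Hypotheses (EE : E *m E^T = 1%:M) (EF : E *m F^T = 0) (FF : F *m F^T = 1%:M).
Variable c : chart R n M.
Hypothesis Ac : A c.

Lemma smooth_param : smooth (coord c @` dom c) (X \o param c).
Proof. by have [] := hX Ac. Qed.

Lemma gauss_map_chart_dom :
  coord c @` (dom c `&` gauss_map A X @^-1` dom (graph_chart E F)) =
  [set x | (coord c @` dom c) x /\ 0 < \det ('J (X \o param c) x *m E^T)].
Proof.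
apply/seteqP; split=> x.
  move=> [p [cp dp] <-]; split; first by exists p.
  exact: ((graph_chart_dom EE EF FF (gauss_map_basis Ac cp)).1 dp).
move=> [[p cp <-] dx]; exists p => //; split=> //.
exact: ((graph_chart_dom EE EF FF (gauss_map_basis Ac cp)).2 dx).
Qed.

Lemma gauss_map_chart_dom_open :
  open (coord c @` (dom c `&` gauss_map A X @^-1` dom (graph_chart E F))).
Proof.
have Uo := om_image_open hM Ac.
rewrite gauss_map_chart_dom openE => x [Ux dx].
have dcont : {for x, continuous (fun y => \det ('J (X \o param c) y *m E^T))}.
  apply: (@scalarC_continuous _ _ _ 0) Ux; apply: (scalarC_det Uo).
  apply: (mxCM Uo); first exact: smooth_jacobian smooth_param.
  exact: mxC_cst.
have nd : \near x, 0 < \det ('J (X \o param c) x *m E^T).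
  exact: (cvgr_gt _ dcont _ dx).
have nU : nbhs x (coord c @` dom c) by apply: open_nbhs_nbhs.
by apply: filterS2 nd nU => y.
Qed.

Lemma gauss_map_coord x :
  (coord c @` (dom c `&` gauss_map A X @^-1` dom (graph_chart E F))) x ->
  (coord (graph_chart E F) \o gauss_map A X \o param c) x =
  mxvec (invmx ('J (X \o param c) x *m E^T) *m ('J (X \o param c) x *m F^T)).
Proof.
rewrite gauss_map_chart_dom => -[[p cp <-] dx].
rewrite /= (om_coordK hM Ac cp).
exact: (graph_chart_coord EE EF FF (gauss_map_basis Ac cp) dx).
Qed.

Lemma gauss_map_chart_smooth :
  smooth (coord c @` (dom c `&` gauss_map A X @^-1` dom (graph_chart E F)))
    (coord (graph_chart E F) \o gauss_map A X \o param c).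
Proof.
have Wo := gauss_map_chart_dom_open; apply/(smooth_scalarC _ Wo) => k a.
have sub x : (coord c @` (dom c `&` gauss_map A X @^-1` dom (graph_chart E F))) x ->
    (coord c @` dom c) x by rewrite gauss_map_chart_dom => -[].
have sX : smooth (coord c @` (dom c `&` gauss_map A X @^-1` dom (graph_chart E F))) (X \o param c).
  exact: smooth_subset sub smooth_param.
have CJ p (B : 'M[R]_(p, m + n)) : mxC k
    (coord c @` (dom c `&` gauss_map A X @^-1` dom (graph_chart E F)))
    (fun x => 'J (X \o param c) x *m B^T).
  by apply: (mxCM Wo); [exact: smooth_jacobian sX|exact: mxC_cst].
case/mxvec_indexP: a => i b.
apply: (@eq_scalarC _ _ _ Wo _ (fun x =>
    (invmx ('J (X \o param c) x *m E^T) *m ('J (X \o param c) x *m F^T)) i b)).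
  by move=> x Wx; rewrite (gauss_map_coord Wx) mxvecE.
have := mxCM Wo (mxC_inv Wo _ (CJ _ E)) (CJ _ F); apply.
move=> x; rewrite gauss_map_chart_dom => -[_ dx].
by rewrite unitmxE unitfE gt_eqF.
Qed.

End GaussMapCharts.

Theorem corollary2p1 (R : realType) (m n : nat) (M : topologicalType)
    (A : set (chart R n M)) (X : M -> 'rV[R]_(m + n))
    (hM : oriented_manifold A) (hX : self_shrinker A X) :
  weighted_harmonic A (induced_metric X)
    (@grassmannian_atlas R n m) (@grassmannian_metric R n m)
    (gaussian_weight X) (gauss_map A X).
Proof.
have [iX shX] := hX; split.
  move=> c d Ac [E [F [EE EF FF ->]]]; split.
    exact: gauss_map_chart_dom_open.
  exact: gauss_map_chart_smooth.
move=> c d p Ac [E [F [EE EF FF ->]]] cp dp.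
have Wo := gauss_map_chart_dom_open hM iX EE EF FF Ac.
(* The tension is computed on the part of the chart whose tangent planes lie in the domain of the
   graph chart. *)
pose W := coord c @` (dom c `&` gauss_map A X @^-1` dom (graph_chart E F)).
have Wp : W (coord c p) by exists p.
have WE x : W x -> exists2 q, dom c q & x = coord c q /\ 0 < \det ('J (X \o param c) x *m E^T).
  by rewrite /W (gauss_map_chart_dom hM iX EE EF FF Ac) => -[[q cq <-] dq]; exists q.
have sX : smooth W (X \o param c).
  have [sUX _] := iX _ Ac; apply: smooth_subset sUX => x /WE[q cq [-> _]].
  by exists q.
apply: (gauss_map_tension EE EF FF Wo sX) Wp.
- by move=> x /WE[q cq [-> _]]; have [_] := iX _ Ac; apply.
- by move=> x /WE[q cq [_]].
- move=> x /WE[q cq [-> _]].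
  (* The shrinker equation is stated with [X q], the chart computation with [X \o param c] at
     [coord c q]. *)
  have := shX c q Ac cq; rewrite -[X in normal_part _ (_ X)](om_coordK hM Ac cq).
  exact.
- exact: gauss_map_coord.
Qed.
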